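(* For every integer $g \geq 0$, the radius of convergence of the formal power series \[ \vec{\mathbf{F}}_g(z) = \sum_{d=1}^{\infty} \Big( \sum_{\alpha,\beta \vdash d} \vec{H}_g(\alpha,\beta) \Big) \frac{z^d}{d!} \] is at least $1/54$ and at most $2/27$.
   Context: For $d \geq 1$, the symmetric group $S(d)$ is viewed as its right Cayley graph with respect to all transpositions. Each transposition is written $(s\ t)$ with $s<t$, and $t$ is called its colour. An $r$-step walk from $\rho \in S(d)$ is a sequence of transpositions $((s_1\ t_1),\dots,(s_r\ t_r))$, $s_i<t_i$; it ends at $\sigma = \rho (s_1\ t_1)\cdots(s_r\ t_r)$. The walk is monotone if $t_1 \leq t_2 \leq \dots \leq t_r$. It is transitive if the subgroup of $S(d)$ generated by $\rho$, $\sigma$ and the transpositions $(s_i\ t_i)$ acts transitively on $\{1,\dots,d\}$. For partitions $\alpha,\beta$ of $d$, with $\ell(\cdot)$ denoting the number of parts, and for an integer $g \geq 0$, put $r_g(\alpha,\beta) = 2g-2+\ell(\alpha)+\ell(\beta)$. The monotone double Hurwitz number $\vec{H}_g(\alpha,\beta)$ is the number of pairs consisting of a starting permutation $\rho$ of cycle type $\alpha$ and a monotone transitive $r_g(\alpha,\beta)$-step walk from $\rho$ whose endpoint has cycle type $\beta$. *)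

(* Defs.v *)
From mathcomp Require Import all_boot all_fingroup.

Set Implicit Arguments.
Unset Strict Implicit.
Unset Printing Implicit Defensive.

Local Open Scope nat_scope.

Fixpoint parts_bnd (fuel n m : nat) : seq (seq nat) :=
  if n == 0 then [:: [::]] else
  match fuel with
  | 0 => [::]
  | fuel'.+1 =>
      flatten [seq [seq k :: p | p <- parts_bnd fuel' (n - k) k]
              | k <- iota 1 (minn n m)]
  end.

Definition partitions (d : nat) : seq (seq nat) := parts_bnd d d d.

Definition cycle_type (d : nat) (s : {perm 'I_d}) : seq nat :=
  sort geq [seq #|pred_of_set c| | c <- enum (porbits s)].

(* A walk of r steps: for each step i a pair (s_i, t_i) encoding the
   transposition (s_i t_i); it is a genuine transposition iff s_i < t_i,
   and t_i is its colour. *)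
Definition walk (d r : nat) := {ffun 'I_r -> 'I_d * 'I_d}.

Definition is_walk d r (w : walk d r) : bool :=
  [forall i, (w i).1 < (w i).2].

Definition transp d r (w : walk d r) (i : 'I_r) : {perm 'I_d} :=
  tperm (w i).1 (w i).2.

Definition endpoint d r (rho : {perm 'I_d}) (w : walk d r) : {perm 'I_d} :=
  (rho * \prod_(i < r) transp w i)%g.

Definition monotone d r (w : walk d r) : bool :=
  [forall i : 'I_r, forall j : 'I_r, (i <= j) ==> ((w i).2 <= (w j).2)].

Definition transitive_walk d r (rho : {perm 'I_d}) (w : walk d r) : bool :=
  [transitive
     <<([set rho; endpoint rho w] :|: [set transp w i | i : 'I_r])>>%g,
   on [set: 'I_d] | 'P].

(* r_g(alpha,beta) = 2g - 2 + l(alpha) + l(beta)  (always >= 0 for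
   partitions of d >= 1). *)
Definition r_g (g : nat) (al be : seq nat) : nat :=
  (2 * g + size al + size be) - 2.

Definition monHurwitz (d g : nat) (al be : seq nat) : nat :=
  #|[set pw : {perm 'I_d} * walk d (r_g g al be) |
      [&& cycle_type pw.1 == al,
          is_walk pw.2,
          monotone pw.2,
          transitive_walk pw.1 pw.2 &
          cycle_type (endpoint pw.1 pw.2) == be]]|.

Definition Fcoef (g d : nat) : nat :=
  \sum_(al <- partitions d) \sum_(be <- partitions d) monHurwitz d g al be.

From Stdlib Require Import Reals.
From Coquelicot Require Import Coquelicot.

Definition Fseries (g : nat) (d : nat) : R :=
  if (d == 0)%nat then 0%R else (INR (Fcoef g d) / INR (factorial d))%R.

(* Main.v *)
Require Import Defs.
From Stdlib Require Import Reals.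
From Coquelicot Require Import Coquelicot.
From Stdlib Require Lra Lia.
From mathcomp Require all_boot all_order all_fingroup all_algebra.
From mathcomp Require zify.zify algebra_tactics.ring algebra_tactics.lra Rstruct.

(** Every permutation has a strictly monotone factorisation of minimal length, so a
    transitive monotone walk from [rho] to [sigma] is a word [e h e'] in transpositions
    whose product is the identity, with [e], [e'] strictly monotone.  Sums of
    transpositions of a given colour are Jucys-Murphy elements; they commute, the
    commutation preserves the generated group, and [(1 + x)^2 / (1 - x)] has coefficients
    at most [4].  Hence the coefficients of [F_g] are at most [4^d] times the number of
    transitive monotone loops at the identity; they are also at least the number of
    planar such loops.

    Since complete symmetric functions of the Jucys-Murphy elements do not depend on the
    order of the points, walks from the identity can be counted by the cycle lengths of
    their endpoint alone.  Removing the last step yields the loop equation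
    [CN_(r+1)(a, A) = sum (CN_r(i, j, A) + CN(i, A1) CN(j, A2)) + sum_b b CN_r(a + b, A \ b)].
    With fixed points counted by an exponential variable [u = 2 s^2 (1 - 2 s)],
    [1/3 < s < 1/2], the planar equation [psi_a = [a = 1] + sum psi_i psi_j + u psi_(a+1)]
    has an explicit solution in Catalan numbers, and its linearisation has a strictly
    positive supersolution [y^a].  By induction on the complexity, this bounds all genera
    at every [u < 2/27], which gives [1/54].  The supersolution also makes the planar
    solution unique, so the planar series in [u] equals [(6 s - 1) / (8 s^2)]; its second
    derivative blows up at [s = 1/3], that is at [u = 2/27]. *)

(** Connectedness is invisible in the group algebra of the symmetric group, so the Jucys-Murphy
    calculus runs in a ring of integer matrices acting on states that remember closed sets.
    Convergence is unknown at the outset, so generating functions are truncated by the number of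
    steps; the loop equation then becomes an inequality, and bounds follow by induction on the
    truncation. In every topology other than the disk, the terms of top complexity are multiplied by
    disk functions or by [u]: one linear operator, hence one critical value, serves all genera. The
    parametrisation comes from the ansatz [2 s q^-(a+1) (C_a - kap C_(a+1))] with Catalan numbers
    [C_a]: matching coefficients in the planar equation determines [q], [kap] and [u] in terms of
    [s]. As [s] falls from [1/2] to [1/3], [u] rises from [0] to [2/27], where
    [du/ds = 4 s (1 - 3 s)] vanishes; [1/54] is [2/27] divided by the [4] of [4^d]. The planar
    series bounds the radius from above in every genus because a loop can be lengthened without
    losing monotonicity. *)

Module JucysMurphy.
Import all_boot all_fingroup all_algebra.
Set Implicit Arguments.
Unset Strict Implicit.
Unset Printing Implicit Defensive.
Import GRing.Theory.
Local Open Scope nat_scope.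

(** * Monotone words and symmetric functions of Jucys-Murphy elements *)

Section Words.
Variable X : finType.
Implicit Types (b : seq X) (w : seq (X * X)).

(* [b] lists the points from the largest to the smallest; the letter [(s, m)] is the
   transposition of [s] and [m], of colour [m]. *)
Fixpoint mon b : nat -> seq (seq (X * X)) :=
  if b is m :: b' then
    fix mon_m r := if r is r'.+1
      then mon b' r ++ [seq rcons w (s, m) | w <- mon_m r', s <- b']
      else [:: [::]]
  else fun r => if r is 0 then [:: [::]] else [::].

Fixpoint smon b : nat -> seq (seq (X * X)) :=
  if b is m :: b' then fun r =>
    smon b' r ++
    (if r is r'.+1 then [seq rcons w (s, m) | w <- smon b' r', s <- b'] else [::])
  else fun r => if r is 0 then [:: [::]] else [::].

Lemma monS m b r :
  mon (m :: b) r.+1 =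
  mon b r.+1 ++ [seq rcons w (s, m) | w <- mon (m :: b) r, s <- b].
Proof. by []. Qed.

Lemma mon0 b : mon b 0 = [:: [::]].
Proof. by case: b. Qed.

Lemma smonS m b r :
  smon (m :: b) r.+1 =
  smon b r.+1 ++ [seq rcons w (s, m) | w <- smon b r, s <- b].
Proof. by []. Qed.

Lemma smon0 b : smon b 0 = [:: [::]].
Proof. by elim: b => // m b /= ->. Qed.

End Words.

(* Transpositions enter only through symmetry and conjugation; [T i j ^+ 2 = 1] is not
   assumed, since it fails once connectedness is recorded. *)
Section Quandle.
Variables (X : finType) (R : pzRingType) (T : X -> X -> R).
Hypothesis Tsym : forall i j, T i j = T j i.
Hypothesis Tconj : forall i j k l,
  (T i j * T k l = T (tperm i j k) (tperm i j l) * T i j)%R.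
Local Open Scope ring_scope.
Implicit Types (b : seq X).

Definition JM b m : R := \sum_(s <- b) T s m.

Fixpoint hsymm b : nat -> R :=
  if b is m :: b' then
    fix h_m r := if r is r'.+1 then hsymm b' r + h_m r' * JM b' m else 1
  else fun r => (r == 0)%:R.

Fixpoint esymm b : nat -> R :=
  if b is m :: b' then fun r =>
    esymm b' r + (if r is r'.+1 then esymm b' r' * JM b' m else 0)
  else fun r => (r == 0)%:R.

Arguments hsymm : simpl never.
Arguments esymm : simpl never.

Lemma hsymm_nil r : hsymm [::] r = (r == 0)%:R. Proof. by []. Qed.
Lemma esymm_nil r : esymm [::] r = (r == 0)%:R. Proof. by []. Qed.

Lemma hsymmS m b r : hsymm (m :: b) r.+1 = hsymm b r.+1 + hsymm (m :: b) r * JM b m.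
Proof. by []. Qed.

Lemma hsymm0 b : hsymm b 0 = 1.
Proof. by case: b. Qed.

Lemma esymmS m b r : esymm (m :: b) r.+1 = esymm b r.+1 + esymm b r * JM b m.
Proof. by []. Qed.

Lemma esymm0 b : esymm b 0 = 1.
Proof. by elim: b => // m b IH; rewrite /esymm -/esymm IH addr0. Qed.

Lemma JM_perm b b' m : perm_eq b b' -> JM b m = JM b' m.
Proof. exact: perm_big. Qed.

Lemma JM_cons x b m : JM (x :: b) m = T x m + JM b m.
Proof. by rewrite /JM big_cons. Qed.

Lemma perm_map_tperm b i j : uniq b -> i \in b -> j \in b ->
  perm_eq (map (tperm i j) b) b.
Proof.
move=> Ub ib jb; apply: uniq_perm => //; first by rewrite map_inj_uniq //; apply: perm_inj.
move=> x; apply/mapP/idP => [[y yb ->]|xb].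
  by case: tpermP => // <-.
by exists (tperm i j x); rewrite ?tpermK //; case: tpermP.
Qed.

(** Conjugation by [tperm i j] permutes the summands of [JM b m], since it fixes [m] and preserves
    [b]. *)
Lemma JM_comm b m i j : uniq (m :: b) -> i \in b -> j \in b ->
  T i j * JM b m = JM b m * T i j.
Proof.
move=> /andP[mb Ub] ib jb; rewrite /JM mulr_sumr mulr_suml.
have mi : i != m by apply: contraNneq mb => <-.
have mj : j != m by apply: contraNneq mb => <-.
under eq_bigr => s _ do rewrite Tconj (tpermD mi mj).
rewrite -(big_map (tperm i j) predT (fun s => T s m * T i j)).
by apply: perm_big; apply: perm_map_tperm.
Qed.

Lemma JM_JM_comm b m k b' : uniq (m :: b) -> k \in b -> {subset b' <= b} ->
  JM b' k * JM b m = JM b m * JM b' k.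
Proof.
move=> U kb sb; rewrite [JM b' k]/JM mulr_suml [RHS]mulr_sumr.
by apply: eq_big_seq => s sb'; rewrite (JM_comm U (sb _ sb') kb).
Qed.

Lemma JM_hsymm_comm b m b' r : uniq (m :: b) -> {subset b' <= b} ->
  hsymm b' r * JM b m = JM b m * hsymm b' r.
Proof.
move=> U; elim: b' r => [|k b' IHb] r sb.
  by rewrite ?(hsymm_nil, esymm_nil); case: r => [|r]; rewrite ?mulr1 ?mul1r ?mul0r ?mulr0.
have sb' : {subset b' <= b} by move=> x xb; apply: sb; rewrite inE xb orbT.
elim: r => [|r IHr]; first by rewrite hsymm0 mulr1 mul1r.
rewrite hsymmS mulrDl mulrDr IHb //; congr (_ + _).
have kb : k \in b by apply: sb; rewrite mem_head.
by rewrite -mulrA (JM_JM_comm U kb sb') mulrA IHr mulrA.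
Qed.

Lemma JM_esymm_comm b m b' r : uniq (m :: b) -> {subset b' <= b} ->
  esymm b' r * JM b m = JM b m * esymm b' r.
Proof.
move=> U; elim: b' r => [|k b' IHb] r sb.
  by rewrite ?(hsymm_nil, esymm_nil); case: r => [|r]; rewrite ?mulr1 ?mul1r ?mul0r ?mulr0.
have sb' : {subset b' <= b} by move=> x xb; apply: sb; rewrite inE xb orbT.
case: r => [|r]; first by rewrite esymm0 mulr1 mul1r.
rewrite esymmS mulrDl mulrDr IHb //; congr (_ + _).
have kb : k \in b by apply: sb; rewrite mem_head.
by rewrite -mulrA (JM_JM_comm U kb sb') mulrA IHb // mulrA.
Qed.

(** The recurrence [h_(r+2) - h_(r+1) e_1 + h_r e_2] attached to the product
    [(1 - J_i x) (1 - J_j x)], with the negative term moved across. *)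
Lemma hsymm2 i j b r :
  hsymm (i :: j :: b) r.+2 + hsymm (i :: j :: b) r * (JM (j :: b) i * JM b j) =
  hsymm b r.+2 + hsymm (i :: j :: b) r.+1 * (T j i + JM b i + JM b j).
Proof.
rewrite hsymmS [hsymm (j :: b) _]hsymmS -JM_cons mulrDr -!addrA; congr (_ + _).
by rewrite addrCA; congr (_ + _); rewrite mulrA -mulrDl -hsymmS.
Qed.

(* Both orders give the same elementary symmetric functions of the two last
   Jucys-Murphy elements, and these determine the complete ones. *)
Lemma hsymm_swap i j b r : uniq [:: i, j & b] ->
  hsymm (i :: j :: b) r = hsymm (j :: i :: b) r.
Proof.
move=> U; have U1 : uniq (i :: j :: b) by [].
have Uji : uniq (j :: i :: b).
  by move: U; rewrite /= !inE !negb_or eq_sym => /and3P[/andP[-> ->] -> ->].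
(* Conjugation by [T i' j'] turns [JM b j'] into [JM b i']; this makes the second elementary
   symmetric function symmetric in the two points. *)
have e2 i' j' : uniq [:: i', j' & b] ->
    JM (j' :: b) i' * JM b j' = T i' j' * JM b i' + JM b j' * JM b i'.
  move=> U'; rewrite -(JM_JM_comm (k := j')) ?mem_head //; last first.
    by move=> x xb; rewrite inE xb orbT.
  rewrite JM_cons mulrDr; congr (_ + _).
  rewrite /JM mulr_suml mulr_sumr; apply: eq_big_seq => s sb.
  have [si sj] : i' != s /\ j' != s.
    move: U'; rewrite /= !inE negb_or => /and3P[/andP[_ ib] jb _].
    by split; [apply: contraNneq ib => -> | apply: contraNneq jb => ->].
  by rewrite [T i' j']Tsym [RHS]Tconj (tpermD sj si) tpermR.
elim/ltn_ind: r => -[|[|r]] IH.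
- by rewrite !hsymm0.
- rewrite !hsymmS !hsymm0 !mul1r !JM_cons [T j i]Tsym -!addrA; congr (_ + _).
  by rewrite addrC -addrA addrCA.
have E2 : JM (j :: b) i * JM b j = JM (i :: b) j * JM b i.
  by rewrite e2 // JM_cons mulrDl.
apply: (addIr (hsymm (i :: j :: b) r * (JM (j :: b) i * JM b j))).
rewrite hsymm2 E2 (IH r) // (IH r.+1) // hsymm2 [T j i]Tsym.
by rewrite -[_ + JM b i + _]addrA [JM b i + _]addrC addrA.
Qed.

Lemma hsymm_cons_congr m b b' : perm_eq b b' ->
  (forall r, hsymm b r = hsymm b' r) -> forall r, hsymm (m :: b) r = hsymm (m :: b') r.
Proof.
move=> pbb E; elim=> [|r IH]; first by rewrite !hsymm0.
by rewrite !hsymmS E IH (JM_perm _ pbb).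
Qed.

Lemma hsymm_perm b b' r : uniq b -> perm_eq b b' -> hsymm b r = hsymm b' r.
Proof.
elim: b b' r => [|x b IH] b' r; first by rewrite perm_sym => _ /perm_nilP ->.
move=> U pb; have xb' : x \in b' by rewrite -(perm_mem pb) mem_head.
have U' : uniq b' by rewrite -(perm_uniq pb).
case/splitPr: xb' pb U' => t1 t2 pb U'.
have pb2 : perm_eq b (t1 ++ t2).
  by rewrite -(perm_cons x) (perm_trans pb) // -cat1s perm_catCA.
have Ub : uniq b by case/andP: U.
have U2 : uniq (x :: t1 ++ t2).
  by rewrite -[x :: _]/([:: x] ++ _) (perm_uniq (permEl (perm_catCA _ _ _))).
rewrite (hsymm_cons_congr x pb2); last by move=> k; apply: IH.
elim: t1 r U2 {pb pb2 U'} => // y t1 IHt r U2.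
rewrite hsymm_swap //; apply: hsymm_cons_congr => [|k].
  by rewrite -cat1s perm_catCA.
apply: IHt; move: U2 => /= /andP[]; rewrite inE negb_or => /andP[_ ->].
by case/andP.
Qed.

Lemma esymm_hsymm_comm b a c : uniq b -> esymm b a * hsymm b c = hsymm b c * esymm b a.
Proof.
elim: b a c => [|m b IH] a c U.
  by rewrite hsymm_nil esymm_nil; case: a c => [|a] [|c]; rewrite ?(mulr0, mul0r, mulr1).
have Ub : uniq b by case/andP: U.
have eJ : GRing.comm (esymm (m :: b) a) (JM b m).
  case: a => [|a]; first by rewrite esymm0; apply: commr_sym; apply: commr1.
  rewrite esymmS; apply: commr_sym; apply: commrD; last apply: commrM => //.
    by apply: commr_sym; rewrite /GRing.comm JM_esymm_comm.
  by apply: commr_sym; rewrite /GRing.comm JM_esymm_comm.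
have eh k : GRing.comm (esymm (m :: b) a) (hsymm b k).
  case: a {eJ} => [|a]; first by rewrite esymm0; apply: commr_sym; apply: commr1.
  rewrite esymmS; apply: commr_sym; apply: commrD; last apply: commrM => //.
  - by rewrite /GRing.comm IH.
  - by rewrite /GRing.comm IH.
  - by rewrite /GRing.comm JM_hsymm_comm.
elim: c => [|c IHc]; first by rewrite hsymm0 mulr1 mul1r.
by rewrite hsymmS; apply: commrD => //; apply: commrM.
Qed.

Definition eh_conv b n : R := \sum_(a < n.+1) esymm b a * hsymm b (n - a).

Lemma eh_convC b n : uniq b ->
  eh_conv b n = \sum_(a < n.+1) hsymm b (n - a) * esymm b a.
Proof. by move=> U; apply: eq_bigr => a _; rewrite esymm_hsymm_comm. Qed.

Lemma eh_convS m b n : uniq (m :: b) ->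
  eh_conv (m :: b) n.+1 =
  eh_conv b n.+1 + eh_conv b n * JM b m + eh_conv (m :: b) n * JM b m.
Proof.
move=> U; rewrite {1}/eh_conv big_ord_recr /= subnn.
have -> : \sum_(i < n.+1) esymm (m :: b) i * hsymm (m :: b) (n.+1 - i) =
  \sum_(i < n.+1) esymm (m :: b) i * hsymm b (n.+1 - i) + eh_conv (m :: b) n * JM b m.
  rewrite /eh_conv mulr_suml -big_split /=; apply: eq_bigr => i _.
  by rewrite subSn ?(leq_ord i) // hsymmS mulrDr mulrA.
rewrite addrAC; congr (_ + _).
have -> : \sum_(i < n.+1) esymm (m :: b) i * hsymm b (n.+1 - i) +
    esymm (m :: b) n.+1 * 1 = \sum_(i < n.+2) esymm (m :: b) i * hsymm b (n.+1 - i).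
  by rewrite [RHS]big_ord_recr /= subnn hsymm0.
rewrite big_ord_recl [eh_conv b n.+1]big_ord_recl /= !esymm0 -addrA.
congr (_ + _); rewrite /eh_conv mulr_suml -big_split /=.
apply: eq_bigr => i _; rewrite esymmS mulrDl; congr (_ + _).
by rewrite -!mulrA JM_hsymm_comm.
Qed.

(** [P] stands for nonnegativity: [P (x - y)] reads as [y <= x], and it enters through the closure
    of the cone under sums and products. *)
Variable P : R -> Prop.
Hypotheses (P0 : P 0) (P1 : P 1) (PT : forall i j, P (T i j)).
Hypothesis PD : forall x y, P x -> P y -> P (x + y).
Hypothesis PM : forall x y, P x -> P y -> P (x * y).

Lemma P_sum (I : Type) (r : seq I) (Q : pred I) (F : I -> R) :
  (forall i, Q i -> P (F i)) -> P (\sum_(i <- r | Q i) F i).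
Proof. by move=> H; apply: big_ind. Qed.

Lemma P_JM b m : P (JM b m). Proof. by apply: P_sum. Qed.

Lemma P_esymm b n : P (esymm b n).
Proof.
elim: b n => [|m b IH] n; first by rewrite esymm_nil; case: (n == 0%N).
by rewrite /esymm -/esymm; apply: PD => //; case: n => // n; apply: PM => //; apply: P_JM.
Qed.

Lemma P_hsymm b n : P (hsymm b n).
Proof.
elim: b n => [|m b IH] n; first by rewrite hsymm_nil; case: (n == 0%N).
by elim: n => // n IHn; rewrite hsymmS; apply: PD => //; apply: PM => //; apply: P_JM.
Qed.

Lemma P_muln x n : P x -> P (x *+ n).
Proof. by move=> Px; elim: n => // n IH; rewrite mulrS; apply: PD. Qed.

(* (1 + x) / (1 - x) has coefficients at most 2. *)
Lemma eh_conv_le b n : uniq b -> P (hsymm b n *+ 2 ^ size b - eh_conv b n).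
Proof.
elim: b n => [|m b IH] n U.
  rewrite /eh_conv /= mulr1n big_ord_recl big1 ?addr0 => [|i _]; last first.
    by rewrite esymm_nil mul0r.
  by rewrite esymm_nil /= subn0 mul1r subrr.
have Ub : uniq b by case/andP: U.
(* With [J = JM b m], [G] has generating function [EH / (1 - J x)], where [EH] is that of
   [eh_conv b]; then use [(1 + J x) / (1 - J x) = 2 / (1 - J x) - 1]. *)
pose G := fix G n := if n is k.+1 then eh_conv b n + G k * JM b m else eh_conv b 0.
have GE k : eh_conv (m :: b) k + eh_conv b k = G k *+ 2.
  elim: k => [|k IHk].
    by rewrite /= mulr2n /eh_conv !big_ord1 !esymm0 !hsymm0.
  rewrite eh_convS //= -[LHS]addrA addrC addrA addrC mulrnDl -mulrnAl -IHk mulrDl mulr2n.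
  by rewrite [RHS]addrC [_ * _ + eh_conv b k * _]addrC -!addrA.
have GP k : P (hsymm (m :: b) k *+ 2 ^ size b - G k).
  elim: k => [|k IHk]; first by have := IH 0 Ub; rewrite !hsymm0.
  rewrite hsymmS /= mulrnDl opprD addrACA; apply: PD; first exact: IH.
  by rewrite -mulrnAl -mulrBl; apply: PM => //; apply: P_JM.
have -> : hsymm (m :: b) n *+ 2 ^ size (m :: b) - eh_conv (m :: b) n =
   (hsymm (m :: b) n *+ 2 ^ size b - G n) *+ 2 + eh_conv b n.
  rewrite mulrnBl -GE opprD -!addrA addNr addr0 /= expnS mulnC mulrnA.
  by rewrite [RHS]addrA -mulr2n.
apply: PD; first exact: P_muln.
by apply: P_sum => i _; apply: PM; [apply: P_esymm | apply: P_hsymm].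
Qed.

Lemma ehe_conv_le b n : uniq b ->
  P (hsymm b n *+ 4 ^ size b -
     \sum_(e < n.+1) \sum_(a < (n - e).+1) esymm b a * hsymm b (n - e - a) * esymm b e).
Proof.
(* The bound on [eh_conv] is used twice; the two uses fit together because [hsymm] and [esymm]
   commute. *)
move=> U; have -> : hsymm b n *+ 4 ^ size b -
     \sum_(e < n.+1) \sum_(a < (n - e).+1) esymm b a * hsymm b (n - e - a) * esymm b e =
   (hsymm b n *+ 2 ^ size b - eh_conv b n) *+ 2 ^ size b +
   \sum_(e < n.+1) (hsymm b (n - e) *+ 2 ^ size b - eh_conv b (n - e)) * esymm b e.
  under [in RHS]eq_bigr => e _ do rewrite mulrBl mulrnAl.
  rewrite big_split /= sumrMnl -eh_convC // mulrnBl addrA subrK -mulrnA -expnMn.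
  rewrite sumrN; congr (_ - _); apply: eq_bigr => e _.
  by rewrite /eh_conv mulr_suml.
apply: PD; first by apply: P_muln; apply: eh_conv_le.
by apply: P_sum => e _; apply: PM; [apply: eh_conv_le | apply: P_esymm].
Qed.

End Quandle.

Arguments mon : simpl never.
Arguments smon : simpl never.

(** * Words as matrices acting on states *)

Section States.
Variable X : finType.
Implicit Types (b : seq X) (w : seq (X * X)) (C : {set X}).

Definition tp (p : X * X) : {perm X} := tperm p.1 p.2.
Definition prodw w : {perm X} := (\prod_(p <- w) tp p)%g.
Definition clw w C := all (fun p => (p.1 \in C) == (p.2 \in C)) w.
(** A set is closed when no letter crosses its boundary; so this says that the letters connect the
    points of [b]. *)
Definition transw w b :=
  [forall C : {set X}, clw w C ==>
     (all [predC C] b || all (mem C) b)].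

(* A word acts on pairs made of a permutation and a family of closed sets.  Unlike the
   set of letters, this pair is invariant under the conjugation moves [act_conj], and it
   still determines [transw]. *)
Definition state : finType := ({perm X} * {set {set X}})%type.
Definition act (st : state) (p : X * X) : state :=
  ((st.1 * tp p)%g, st.2 :&: [set C : {set X} | (p.1 \in C) == (p.2 \in C)]).
Definition stw w : state := (prodw w, [set C | clw w C]).

Lemma prodw_cat w1 w2 : prodw (w1 ++ w2) = (prodw w1 * prodw w2)%g.
Proof. by rewrite /prodw big_cat. Qed.

Lemma prodw_rcons w p : prodw (rcons w p) = (prodw w * tp p)%g.
Proof. by rewrite -cats1 prodw_cat /prodw big_seq1. Qed.

Lemma clw_rcons w p C : clw (rcons w p) C = clw w C && ((p.1 \in C) == (p.2 \in C)).
Proof. by rewrite /clw all_rcons andbC. Qed.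

Lemma stw_rcons w p : stw (rcons w p) = act (stw w) p.
Proof.
by rewrite /stw /act prodw_rcons; congr (_, _); apply/setP => C; rewrite !inE clw_rcons.
Qed.

Lemma act_sym st i j : act st (i, j) = act st (j, i).
Proof.
by rewrite /act /tp tpermC /=; congr (_, _ :&: _); apply/setP => C; rewrite !inE eq_sym.
Qed.

Lemma act_conj st i j k l :
  act (act st (i, j)) (k, l) = act (act st (tperm i j k, tperm i j l)) (i, j).
Proof.
rewrite /act /tp /=; congr (_, _).
  by rewrite -!mulgA; congr (_ * _)%g; rewrite -tpermJ conjgE tpermV -!mulgA tperm2 mulg1.
rewrite -!setIA; congr (_ :&: _); apply/setP => C; rewrite !inE.
case: ((i \in C) =P (j \in C)) => eij; rewrite ?andbF //= andbT.
have tC z : (tperm i j z \in C) = (z \in C) by case: tpermP => [->|->|//].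
by rewrite !tC.
Qed.

Local Open Scope ring_scope.

(** The transition matrix of one letter. In a product along [w], the row of the initial state is the
    point mass at [stw w], which turns counts of words into entries of symmetric functions. *)
Definition Tmx (i j : X) : 'M[int]_#|state| :=
  \matrix_(k, l) (enum_val l == act (enum_val k) (i, j))%:R.

Lemma Tmx_mul_entry (A : 'M[int]_#|state|) (st : state) k i j l :
  (forall m, A k m = (enum_val m == st)%:R) ->
  (A * Tmx i j) k l = (enum_val l == act st (i, j))%:R.
Proof.
move=> E; rewrite mxE (bigD1 (enum_rank st)) //= big1 ?addr0 => [|m ne].
  by rewrite E enum_rankK eqxx mul1r mxE enum_rankK.
rewrite E; case: eqP => [em|_]; last by rewrite mul0r.
by rewrite -em enum_valK eqxx in ne.
Qed.

Lemma Tmx_sym i j : Tmx i j = Tmx j i.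
Proof. by apply/matrixP => k l; rewrite !mxE act_sym. Qed.

Lemma Tmx_conj i j k l :
  Tmx i j * Tmx k l = Tmx (tperm i j k) (tperm i j l) * Tmx i j.
Proof.
apply/matrixP => p q.
rewrite (Tmx_mul_entry (st := act (enum_val p) (i, j))); last by move=> m; rewrite mxE.
rewrite (Tmx_mul_entry (st := act (enum_val p) (tperm i j k, tperm i j l))).
  by rewrite act_conj.
by move=> m; rewrite mxE.
Qed.

Definition wmx w : 'M[int]_#|state| := \prod_(p <- w) Tmx p.1 p.2.

Lemma wmx_rcons w p : wmx (rcons w p) = wmx w * Tmx p.1 p.2.
Proof. by rewrite /wmx -cats1 big_cat big_seq1. Qed.

Lemma wmx_cat w1 w2 : wmx (w1 ++ w2) = wmx w1 * wmx w2.
Proof. by rewrite /wmx big_cat. Qed.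

Lemma wmx_entry w l : wmx w (enum_rank (stw [::])) l = (enum_val l == stw w)%:R.
Proof.
elim/last_ind: w l => [|w p IH] l.
  rewrite /wmx big_nil mxE /= -[in RHS](enum_rankK (stw [::])).
  by rewrite (inj_eq enum_val_inj) eq_sym.
by rewrite wmx_rcons (Tmx_mul_entry _ (st := stw w)) // stw_rcons; case: p.
Qed.

Lemma sum_wmx (F : state -> nat) w :
  \sum_l (F (enum_val l))%:R * wmx w (enum_rank (stw [::])) l = (F (stw w))%:R :> int.
Proof.
under eq_bigr => l _ do rewrite wmx_entry.
rewrite (bigD1 (enum_rank (stw w))) //= big1 ?addr0 => [|m ne].
  by rewrite enum_rankK eqxx mulr1.
case: eqP => [em|_]; last by rewrite mulr0.
by rewrite -em enum_valK eqxx in ne.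
Qed.

Lemma hsymm_words b r : hsymm Tmx b r = \sum_(w <- mon b r) wmx w.
Proof.
elim: b r => [|m b IH] r.
  by case: r => [|r]; rewrite hsymm_nil /mon ?big_nil // big_seq1 /wmx big_nil.
elim: r => [|r IHr]; first by rewrite hsymm0 mon0 big_seq1 /wmx big_nil.
rewrite hsymmS IH IHr monS big_cat big_allpairs_dep /=; congr (_ + _).
rewrite mulr_suml; apply: eq_bigr => w _; rewrite /JM mulr_sumr.
by apply: eq_bigr => s _; rewrite wmx_rcons.
Qed.

Lemma esymm_words b r : esymm Tmx b r = \sum_(w <- smon b r) wmx w.
Proof.
elim: b r => [|m b IH] r.
  by case: r => [|r]; rewrite esymm_nil /smon ?big_nil // big_seq1 /wmx big_nil.
case: r => [|r]; first by rewrite esymm0 smon0 big_seq1 /wmx big_nil.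
rewrite esymmS smonS big_cat big_allpairs_dep /= !IH; congr (_ + _).
rewrite mulr_suml; apply: eq_bigr => w _; rewrite /JM mulr_sumr.
by apply: eq_bigr => s _; rewrite wmx_rcons.
Qed.

(** [hsymm] does not see the order of the points; hence neither does the distribution of the states
    of monotone words. *)
Lemma mon_perm (F : state -> nat) b b' r : uniq b -> perm_eq b b' ->
  (\sum_(w <- mon b r) F (stw w))%N = (\sum_(w <- mon b' r) F (stw w))%N.
Proof.
move=> U pb; apply/eqP; rewrite -eqz_nat; apply/eqP; rewrite -!natz !natr_sum.
have E b0 : (\sum_(w <- mon b0 r) (F (stw w))%:R : int) =
   \sum_l (F (enum_val l))%:R * hsymm Tmx b0 r (enum_rank (stw [::])) l.
  rewrite hsymm_words; under [RHS]eq_bigr => l _ do rewrite summxE mulr_sumr.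
  by rewrite exchange_big; apply: eq_bigr => w _; rewrite sum_wmx.
by rewrite !E (hsymm_perm Tmx_sym Tmx_conj r U pb).
Qed.

Definition mx_nneg (A : 'M[int]_#|state|) : Prop := forall i j, (0 <= A i j)%R.

Lemma smon_mon_smon_le (F : state -> nat) b n : uniq b ->
  (\sum_(e < n.+1) \sum_(a < (n - e).+1)
     \sum_(w1 <- smon b a) \sum_(w2 <- mon b (n - e - a)) \sum_(w3 <- smon b e)
      F (stw (w1 ++ w2 ++ w3)) <= 4 ^ size b * \sum_(w <- mon b n) F (stw w))%N.
Proof.
move=> U.
have P0 : mx_nneg 0 by move=> i j; rewrite mxE.
have P1 : mx_nneg 1 by move=> i j; rewrite mxE.
have PT i j : mx_nneg (Tmx i j) by move=> k l; rewrite mxE.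
have PD A B : mx_nneg A -> mx_nneg B -> mx_nneg (A + B).
  by move=> hA hB i j; rewrite mxE Num.Theory.addr_ge0.
have PM A B : mx_nneg A -> mx_nneg B -> mx_nneg (A * B).
  by move=> hA hB i j; rewrite mxE Num.Theory.sumr_ge0 // => k _; rewrite Num.Theory.mulr_ge0.
have := ehe_conv_le Tmx_conj P0 P1 PT PD PM n U.
set S := (\sum_(e < n.+1) _)%R => H.
have SE : S = \sum_(e < n.+1) \sum_(a < (n - e).+1)
     \sum_(w1 <- smon b a) \sum_(w2 <- mon b (n - e - a)) \sum_(w3 <- smon b e)
      wmx (w1 ++ w2 ++ w3).
  apply: eq_bigr => e _; apply: eq_bigr => a _.
  rewrite !esymm_words hsymm_words !mulr_suml; apply: eq_bigr => w1 _.
  rewrite -mulrA mulr_suml mulr_sumr; apply: eq_bigr => w2 _.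
  by rewrite !mulr_sumr; apply: eq_bigr => w3 _; rewrite !wmx_cat.
pose fn (A : 'M[int]_#|state|) : int :=
  \sum_l (F (enum_val l))%:R * A (enum_rank (stw [::])) l.
have fnD A B : fn (A + B) = fn A + fn B.
  by rewrite /fn -big_split; apply: eq_bigr => l _; rewrite mxE mulrDr.
have fn0 : fn 0 = 0 by rewrite /fn big1 // => l _; rewrite mxE mulr0.
have fn_sum (I : Type) (s : seq I) (G : I -> 'M[int]_#|state|) :
    fn (\sum_(i <- s) G i) = \sum_(i <- s) fn (G i).
  by apply: big_morph.
have fnw w : fn (wmx w) = (F (stw w))%:R by apply: sum_wmx.
have fn_nneg A : mx_nneg A -> (0 <= fn A)%R.
  by move=> hA; rewrite /fn Num.Theory.sumr_ge0 // => l _; rewrite Num.Theory.mulr_ge0.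
have fnM A k : fn (A *+ k) = fn A *+ k.
  by elim: k => [|k IH]; rewrite ?mulr0n // !mulrS fnD IH.
have : fn S <= fn (hsymm Tmx b n *+ 4 ^ size b).
  rewrite -[X in _ <= fn X](subrK S) fnD Num.Theory.lerDr; exact: fn_nneg.
rewrite fnM hsymm_words fn_sum SE fn_sum -mulr_natl.
rewrite -(Num.Theory.ler_nat int) natrM !natr_sum.
rewrite [X in _ * X](eq_bigr _ (fun w _ => fnw w)); congr (_ <= _).
apply: eq_bigr => e _; rewrite fn_sum natr_sum; apply: eq_bigr => a _.
rewrite fn_sum natr_sum; apply: eq_bigr => w1 _.
rewrite fn_sum natr_sum; apply: eq_bigr => w2 _.
by rewrite fn_sum natr_sum; apply: eq_bigr => w3 _; apply: fnw.
Qed.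

End States.

End JucysMurphy.

(** * The loop equation for connected words with prescribed cycles *)

Module LoopEquation.
Import all_boot all_fingroup JucysMurphy.
Set Implicit Arguments.
Unset Strict Implicit.
Unset Printing Implicit Defensive.
Local Open Scope nat_scope.

Section Lists.
Variable T : Type.
Implicit Types l : seq T.

Fixpoint splits l : seq (seq T * seq T) :=
  if l is x :: l' then
    [seq (x :: p.1, p.2) | p <- splits l'] ++ [seq (p.1, x :: p.2) | p <- splits l']
  else [:: ([::], [::])].

Fixpoint picks l : seq (T * seq T) :=
  if l is x :: l' then (x, l') :: [seq (p.1, x :: p.2) | p <- picks l'] else [::].

Lemma big_splits_cons (F : seq T * seq T -> nat) x l :
  \sum_(p <- splits (x :: l)) F p =
  \sum_(p <- splits l) F (x :: p.1, p.2) + \sum_(p <- splits l) F (p.1, x :: p.2).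
Proof. by rewrite /= big_cat !big_map. Qed.

Lemma big_picks_cons (F : T * seq T -> nat) x l :
  \sum_(p <- picks (x :: l)) F p =
  F (x, l) + \sum_(p <- picks l) F (p.1, x :: p.2).
Proof. by rewrite /= big_cons big_map. Qed.

(** A predicate sorts a list in exactly one way; this later expresses that the two components of a
    word determine the splitting. *)
Lemma sum_splits_pred (P : pred T) l :
  \sum_(p <- splits l) (all P p.1 && all (predC P) p.2) = 1.
Proof.
elim: l => [|x l IH]; first by rewrite big_seq1.
rewrite big_splits_cons /=; case: (P x) => /=.
  by rewrite IH big1 // => p _; rewrite andbF.
by rewrite big1.
Qed.
End Lists.

Lemma splits_map (T T' : Type) (f : T -> T') l :
  splits (map f l) = [seq (map f p.1, map f p.2) | p <- splits l].
Proof. by elim: l => //= x l ->; rewrite map_cat -!map_comp. Qed.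

Lemma picks_map (T T' : Type) (f : T -> T') l :
  picks (map f l) = [seq (f p.1, map f p.2) | p <- picks l].
Proof. by elim: l => //= x l ->; rewrite -!map_comp. Qed.

Lemma splits_perm (T : eqType) (l : seq T) p :
  p \in splits l -> perm_eq (p.1 ++ p.2) l.
Proof.
elim: l p => [|x l IH] p /=; first by rewrite inE => /eqP ->.
rewrite mem_cat => /orP[] /mapP[q /IH pq ->] /=; first by rewrite perm_cons.
by rewrite -[x :: q.2]cat1s perm_catCA /= perm_cons.
Qed.

Lemma picks_perm (T : eqType) (l : seq T) p :
  p \in picks l -> perm_eq (p.1 :: p.2) l.
Proof.
elim: l p => [|x l IH] p //=; rewrite inE => /orP[/eqP -> //|/mapP[q /IH pq ->]] /=.
by rewrite -[x :: q.2]cat1s -[q.1 :: _]cat1s perm_catCA /= perm_cons.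
Qed.

(* [CN r al] counts the transitive monotone walks of [r] steps from the identity to a
   fixed permutation with cycle lengths [al], the first cycle containing the largest point
   [m].  Undoing the last step [(s, m)] splits that cycle if it contains [s], after which
   the walk may fall apart into two transitive ones, and joins it to the cycle of [s]
   otherwise. *)
Definition CNstep (f : nat -> seq nat -> nat) r al :=
  if al is a :: A then
    \sum_(k < a.-1) (f r [:: k.+1, a.-1 - k & A] +
       \sum_(p <- splits A) \sum_(i < r.+1)
           f i (k.+1 :: p.1) * f (r - i) (a.-1 - k :: p.2))
    + \sum_(p <- picks A) p.1 * f r (a + p.1 :: p.2)
  else 0.

Fixpoint CNf N r al : nat :=
  if N is N'.+1 then
    if r is r'.+1 then CNstep (CNf N') r' al else al == [:: 1]
  else 0.

Definition CN r := CNf r.+1 r.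

Lemma CNstep_eq f g r al : (forall i al, i <= r -> f i al = g i al) ->
  CNstep f r al = CNstep g r al.
Proof.
move=> E; case: al => // a A; rewrite /CNstep; congr (_ + _); last first.
  by apply: eq_bigr => p _; rewrite E.
apply: eq_bigr => k _; rewrite E //; congr (_ + _); apply: eq_bigr => p _.
by apply: eq_bigr => i _; rewrite !E ?leq_subr // -ltnS.
Qed.

Lemma CNf_eq N r al : r < N -> CNf N r al = CN r al.
Proof.
elim/ltn_ind: r N al => -[|r] IH [|N] al // rN.
rewrite -[LHS]/(CNstep (CNf N) r al) -[RHS]/(CNstep (CNf r.+1) r al).
by apply: CNstep_eq => i be ir; rewrite !IH // (leq_ltn_trans ir).
Qed.

Lemma CNS r al : CN r.+1 al = CNstep CN r al.
Proof.
rewrite -[LHS]/(CNstep (CNf r.+1) r al).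
by apply: CNstep_eq => i be ir; rewrite CNf_eq.
Qed.

Lemma CN0 al : CN 0 al = (al == [:: 1]).
Proof. by []. Qed.

Section Comb.
Variable X : finType.
Implicit Types (b : seq X) (w : seq (X * X)) (C : {set X}) (c : seq X) (cs : seq (seq X)).

Definition wC w C := [seq p <- w | p.1 \in C].

Lemma prodw_cons p w : prodw (p :: w) = (tp p * prodw w)%g.
Proof. by rewrite /prodw big_cons. Qed.

Lemma clwC w C : clw w (~: C) = clw w C.
Proof. by apply: eq_all => p; rewrite !inE; do 2![case: (_ \in _)]. Qed.

Lemma tp_stable p C x : (p.1 \in C) = (p.2 \in C) -> (tp p x \in C) = (x \in C).
Proof. by move=> E; rewrite /tp; case: tpermP => [->|->|//]. Qed.

Lemma prodw_stable w C x : clw w C -> (prodw w x \in C) = (x \in C).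
Proof.
elim: w x => [|p w IH] x /=; first by rewrite /prodw big_nil perm1.
by move=> /andP[/eqP E cw]; rewrite prodw_cons permM IH // tp_stable.
Qed.

Lemma prodw_wC w C x : clw w C -> x \in C -> prodw w x = prodw (wC w C) x.
Proof.
elim: w x => [|p w IH] x //= /andP[/eqP E cw] xC.
rewrite prodw_cons permM IH ?tp_stable //; case: ifP => pC.
  by rewrite prodw_cons permM.
congr (prodw _ _); rewrite /tp tpermD //; first by apply: contraFneq pC => ->.
by apply: contraFneq pC => e; rewrite E e.
Qed.

Lemma wC_rcons w p C :
  wC (rcons w p) C = if p.1 \in C then rcons (wC w C) p else wC w C.
Proof. by rewrite /wC filter_rcons. Qed.

Definition mon2 b1 b2 r (F : seq (X * X) -> seq (X * X) -> nat) :=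
  \sum_(r1 < r.+1) \sum_(w1 <- mon b1 r1) \sum_(w2 <- mon b2 (r - r1)) F w1 w2.

Lemma mon2_consl m b1 b2 r F :
  mon2 (m :: b1) b2 r.+1 F = mon2 b1 b2 r.+1 F +
  mon2 (m :: b1) b2 r (fun w1 w2 => \sum_(s <- b1) F (rcons w1 (s, m)) w2).
Proof.
rewrite /mon2 big_ord_recl [in X in _ = X + _]big_ord_recl /= !mon0 -addnA.
congr (_ + _); rewrite -big_split; apply: eq_bigr => i _ /=.
rewrite monS big_cat big_allpairs_dep /bump /= add1n subSS; congr (_ + _).
by apply: eq_bigr => w _; rewrite exchange_big.
Qed.

Lemma mon2_consr m b1 b2 r F :
  mon2 b1 (m :: b2) r.+1 F = mon2 b1 b2 r.+1 F +
  mon2 b1 (m :: b2) r (fun w1 w2 => \sum_(s <- b2) F w1 (rcons w2 (s, m))).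
Proof.
rewrite /mon2 big_ord_recr [in X in _ = X + _]big_ord_recr /= subnn !mon0 addnAC.
congr (_ + _); rewrite -big_split; apply: eq_bigr => i _ /=.
rewrite -big_split; apply: eq_bigr => w _ /=.
by rewrite subSn ?leq_ord // monS big_cat big_allpairs_dep.
Qed.

(* Two monotone words on disjoint sets have exactly one monotone shuffle. *)
Lemma mon_split F C b r :
  \sum_(w <- mon b r | clw w C) F (wC w C) (wC w (~: C)) =
  mon2 [seq x <- b | x \in C] [seq x <- b | x \in ~: C] r F.
Proof.
elim: b r F => [|m b IHb] r F.
  case: r => [|r]; first by rewrite /mon2 !mon0 big_ord1 big_mkcond !big_seq1.
  rewrite big_nil /mon2 big1 // => -[[|i] ir] _ /=.
    by rewrite big1 // => w _; rewrite subn0 big_nil.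
  by rewrite big_nil.
elim: r F => [|r IHr] F.
  by rewrite !mon0 /mon2 big_ord1 !mon0 big_mkcond !big_seq1.
rewrite monS big_cat IHb /= big_mkcond big_allpairs_dep /= inE.
move: IHr; rewrite /= inE => IHr.
case mC: (m \in C) IHr => IHr; rewrite /= ?mon2_consl ?mon2_consr; congr (_ + _);
  rewrite -IHr big_mkcond [RHS]big_mkcond; apply: eq_bigr => w _ /=.
- case cw: (clw w C); last first.
    by rewrite big1 // => s _; rewrite clw_rcons cw.
  rewrite big_filter [RHS]big_mkcond; apply: eq_bigr => s _.
  by rewrite clw_rcons cw /= mC !wC_rcons !inE /=; case: (s \in C).
case cw: (clw w C); last first.
  by rewrite big1 // => s _; rewrite clw_rcons cw.
rewrite big_filter [RHS]big_mkcond; apply: eq_bigr => s _.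
by rewrite clw_rcons cw /= mC !wC_rcons !inE /=; case: (s \in C).
Qed.

Lemma path_tperm (f : {perm X}) s m x c : s \notin c -> m \notin c ->
  path (frel f) x c = path (frel (f * tperm s m)%g) x c.
Proof.
elim: c x => //= y c IH x; rewrite !inE !negb_or => /andP[sy sc] /andP[my mc].
rewrite -IH // permM; congr (_ && _).
by rewrite (canF_eq (tpermK s m)) tpermD.
Qed.

Lemma path_tperm_rcons (f : {perm X}) s m x c : s \notin c -> m \notin c ->
  path (frel f) x (rcons c s) = path (frel (f * tperm s m)%g) x (rcons c m).
Proof.
move=> sc mc; rewrite !rcons_path -path_tperm //; congr (_ && _).
by rewrite /= permM (canF_eq (tpermK s m)) tpermR.
Qed.

Lemma cycle_tperm (f : {perm X}) s m c : s \notin c -> m \notin c ->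
  fcycle f c = fcycle (f * tperm s m)%g c.
Proof.
case: c => //= x c sc mc; apply: path_tperm.
  by rewrite mem_rcons.
by rewrite mem_rcons.
Qed.

(** Applied to the product with the last letter it gives the cut terms of the loop equation, applied
    without that letter the join terms. *)
Lemma cycle_tperm_split (f : {perm X}) s m c1 c2 : uniq (m :: c1 ++ s :: c2) ->
  fcycle f (m :: c1 ++ s :: c2) =
  fcycle (f * tperm s m)%g (m :: c1) && fcycle (f * tperm s m)%g (s :: c2).
Proof.
rewrite /= mem_cat inE !negb_or cat_uniq /= negb_or -!andbA.
move=> /and5P[mc1 ms mc2 uc1 /and4P[sc1 _ sc2 uc2]].
rewrite -cats1 -catA /= -cat_rcons cat_path last_rcons cats1; congr (_ && _).
  exact: path_tperm_rcons.
by rewrite tpermC; apply: path_tperm_rcons.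
Qed.

Definition cycw (f : {perm X}) cs := all (fun c => fcycle f c) cs.

(** [b] fixes the order of the points and [cs] the cycles of the product. In [cnt] the order is read
    off the cycles, so that the head of the first cycle is the largest point. *)
Definition cntb b cs r :=
  \sum_(w <- mon b r) (cycw (prodw w) cs && transw w b : nat).
Definition cnt cs r := cntb (flatten cs) cs r.

Lemma transw_eqi w b b' : b =i b' -> transw w b = transw w b'.
Proof.
by move=> E; apply: eq_forallb => C; rewrite (eq_all_r E) (eq_all_r E).
Qed.

Lemma cntb_perm b cs cs' r : uniq b -> perm_eq b (flatten cs') -> perm_eq cs cs' ->
  cntb b cs r = cnt cs' r.
Proof.
move=> U pb pcs; rewrite /cnt /cntb.
pose F (st : state X) : nat := cycw st.1 cs &&
  [forall C : {set X}, (C \in st.2) ==> (all [predC C] b || all (mem C) b)].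
have FE w : cycw (prodw w) cs && transw w b = F (stw w) :> nat.
  rewrite /F /=; congr (nat_of_bool (_ && _)).
  by apply: eq_forallb => C; rewrite inE.
under eq_bigr => w _ do rewrite FE.
rewrite (mon_perm _ _ U pb); apply: eq_bigr => w _; rewrite -FE.
rewrite /cycw (eq_all_r (perm_mem pcs)); congr (nat_of_bool (_ && _)).
exact/transw_eqi/perm_mem.
Qed.

Lemma mon_letters b r w p : w \in mon b r -> p \in w -> (p.1 \in b) && (p.2 \in b).
Proof.
elim: b r w => [|m b IHb] r w.
  by case: r => [|r]; rewrite /mon ?inE // => /eqP ->.
elim: r w => [|r IHr] w; first by rewrite mon0 inE => /eqP ->.
rewrite monS mem_cat => /orP[wb pw|].
  by have /andP[h1 h2] := IHb _ _ wb pw; rewrite !inE h1 h2 !orbT.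
case/allpairsP => -[w' s] /= [w'm sb ->]; rewrite mem_rcons inE => /orP[/eqP ->|].
  by rewrite !inE /= sb eqxx orbT.
exact: IHr.
Qed.

(** The connected component of [m] under the letters of [w]. *)
Definition comp w m := [set x | [forall C : {set X}, clw w C && (m \in C) ==> (x \in C)]].

Lemma compP w m x : reflect (forall C, clw w C -> m \in C -> x \in C) (x \in comp w m).
Proof.
rewrite inE; apply: (iffP forallP) => H C.
  by move=> c1 c2; have := H C; rewrite c1 c2.
by apply/implyP => /andP[]; apply: H.
Qed.

Lemma clw_comp w m : clw w (comp w m).
Proof.
apply/allP => p pw; apply/eqP; apply/compP/compP => H C cC mC;
  have := H C cC mC; by rewrite (eqP (allP cC _ pw)).
Qed.

Lemma mem_comp w m : m \in comp w m.
Proof. by apply/compP. Qed.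

Lemma path_stable (f : {perm X}) (C : {set X}) x c : (forall y, (f y \in C) = (y \in C)) ->
  path (frel f) x c -> forall y, y \in c -> (y \in C) = (x \in C).
Proof.
move=> fC; elim: c x => //= z c IH x /andP[/eqP <- pc] y.
rewrite inE => /orP[/eqP ->|yc]; first by rewrite fC.
by rewrite (IH _ pc _ yc) fC.
Qed.

Lemma cycle_stable (f : {perm X}) (C : {set X}) c : (forall y, (f y \in C) = (y \in C)) ->
  fcycle f c -> {in c &, forall x y, (x \in C) = (y \in C)}.
Proof.
case: c => //= z c fC pc x y; rewrite -!(mem_rcons c) => xc yc.
by rewrite (path_stable fC pc xc) (path_stable fC pc yc).
Qed.

Lemma transwP w b : reflect (forall C, clw w C -> all [predC C] b \/ all (mem C) b)
  (transw w b).
Proof.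
apply: (iffP forallP) => H C; first by move=> c1; apply/orP; have := H C; rewrite c1.
by apply/implyP => c1; apply/orP/H.
Qed.

End Comb.

Section Comb2.
Variable X : finType.
Implicit Types (b : seq X) (w : seq (X * X)) (C : {set X}) (c : seq X) (cs : seq (seq X)).

Arguments cycw : simpl never.

Lemma cycw_cons (f : {perm X}) c cs : cycw f (c :: cs) = fcycle f c && cycw f cs.
Proof. by []. Qed.

Lemma big_flatten_picks (G : X -> nat) cs :
  \sum_(s <- flatten cs) G s = \sum_(p <- picks cs) \sum_(s <- p.1) G s.
Proof.
elim: cs => [|c cs IH]; first by rewrite !big_nil.
by rewrite big_picks_cons /= big_cat IH.
Qed.

Lemma clw_wC w C D : clw w C ->
  clw (wC w C) D = clw w (D :&: C).
Proof.
move=> cC; rewrite /clw all_filter; apply: eq_in_all => p pw /=.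
rewrite !inE (eqP (allP cC _ pw)); case: (p.2 \in C) => /=; by rewrite ?andbT ?andbF.
Qed.

Lemma clwI w C D : clw w C -> clw w D -> clw w (C :&: D).
Proof.
move=> /allP cC /allP cD; apply/allP => p pw.
by rewrite !inE (eqP (cC _ pw)) (eqP (cD _ pw)).
Qed.

Lemma clwU w C D : clw w C -> clw w D -> clw w (C :|: D).
Proof. by move=> cC cD; rewrite -clwC setCU clwI ?clwC. Qed.

Lemma clw_wC_sub w C D : clw w D -> clw (wC w C) D.
Proof. by move=> /allP cD; apply/allP => p; rewrite mem_filter => /andP[_ /cD]. Qed.

Lemma transw_rconsW w p b : transw w b -> transw (rcons w p) b.
Proof. by move=> /transwP H; apply/transwP => C; rewrite clw_rcons => /andP[/H]. Qed.

(** * Words that fall apart when the last letter [(s, m)] is removed *)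

Section Split.
Variables (m s : X) (c1 c2 : seq X) (cs : seq (seq X)) (w : seq (X * X)) (b : seq X).
Let c1' := m :: c1.
Let c2' := s :: c2.
Hypothesis Ub : uniq b.
Hypothesis pb : perm_eq b (flatten [:: c1', c2' & cs]).
Hypothesis wb : forall p, p \in w -> (p.1 \in b) && (p.2 \in b).
Hypothesis cyc : cycw (prodw w) [:: c1', c2' & cs].
Hypothesis nz : all (fun c => c != [::]) cs.

Let Cp (p : seq (seq X) * seq (seq X)) := [set x in flatten (c1' :: p.1)].
Let Q (p : seq (seq X) * seq (seq X)) :=
  [&& clw w (Cp p), transw (wC w (Cp p)) (flatten (c1' :: p.1))
    & transw (wC w (~: Cp p)) (flatten (c2' :: p.2))].
Let C0 := comp w m.
Let P c := has (mem C0) c.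

Lemma splits_flatten p : p \in splits cs ->
  perm_eq b (flatten (c1' :: p.1) ++ flatten (c2' :: p.2)).
Proof.
move=> /splits_perm ps; apply: (perm_trans pb); rewrite -flatten_cat.
apply: perm_flatten; rewrite perm_sym /= perm_cons -[c2' :: p.2]cat1s perm_catCA /=.
by rewrite perm_cons.
Qed.

Lemma mem_b p x : p \in splits cs ->
  (x \in b) = (x \in flatten (c1' :: p.1)) || (x \in flatten (c2' :: p.2)).
Proof. by move=> /splits_flatten /perm_mem ->; rewrite mem_cat. Qed.

Lemma mem_Cp_l p x : p \in splits cs -> x \in flatten (c1' :: p.1) -> x \in Cp p.
Proof. by move=> _ xl; rewrite inE. Qed.

Lemma mem_Cp_r p x : p \in splits cs -> x \in flatten (c2' :: p.2) -> x \notin Cp p.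
Proof.
move=> ps xr; rewrite inE; apply/negP => xl.
move: Ub; rewrite (perm_uniq (splits_flatten ps)) cat_uniq => /and3P[_ /hasPn H _].
by have := H _ xr; rewrite /= xl.
Qed.

Lemma comp_cycle c : c \in [:: c1', c2' & cs] ->
  {in c &, forall x y, (x \in C0) = (y \in C0)}.
Proof.
move=> cin; apply: (cycle_stable (f := prodw w)); last by have /allP := cyc; apply.
by move=> y; apply: prodw_stable; apply: clw_comp.
Qed.

Lemma splits_mem p c : p \in splits cs -> (c \in p.1) || (c \in p.2) -> c \in cs.
Proof. by move=> /splits_perm /perm_mem <-; rewrite mem_cat. Qed.

(** Removing the last letter leaves at most two components, those of [m] and of [s]. Each remaining
    cycle lies in one of them, so [p] has to sort the cycles by whether they meet the component [C0]
    of [m]. *)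
Lemma Q_trans p : p \in splits cs ->
  Q p = [&& transw (rcons w (s, m)) b, ~~ transw w b, all P p.1 & all (predC P) p.2].
Proof.
move=> ps; have mC : m \in Cp p by rewrite inE /= inE eqxx.
have mb : m \in b by rewrite (mem_b _ ps) /= mem_head.
have sb : s \in b by rewrite (mem_b _ ps) [X in _ || X]mem_head orbT.
have sC : s \notin Cp p by apply: mem_Cp_r => //; rewrite /= mem_head.
apply/and3P/and4P => [[cC /transwP t1 /transwP t2]|[t nt /allP P1 /allP P2]].
  have C0C : C0 \subset Cp p.
    by apply/subsetP => x /compP H; apply: H.
  split.
  - apply/transwP => D; rewrite clw_rcons => /andP[cD /eqP /= smD].
    have := t1 D (clw_wC_sub _ cD); have := t2 D (clw_wC_sub _ cD).
    case=> /= /andP[sD h2] [] /= /andP[mD h1].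
    + left; apply/allP => x; rewrite (mem_b _ ps) /= !inE => /orP[]/orP[/eqP ->|] //.
        exact: (allP h1).
      exact: (allP h2).
    + by rewrite smD mD in sD.
    + by rewrite -smD sD in mD.
    + right; apply/allP => x; rewrite (mem_b _ ps) /= !inE => /orP[]/orP[/eqP ->|] //.
        exact: (allP h1).
      exact: (allP h2).
  - apply/transwP => /(_ _ cC)[/allP/(_ _ mb)|/allP/(_ _ sb)] /=; by rewrite ?mC ?(negbTE sC).
  - apply/allP => c cp; have /allP/(_ c (splits_mem ps _)) := nz; rewrite cp => /(_ isT).
    case: c cp => // x c cp _.
    case: (t1 C0 (clw_wC_sub _ (clw_comp _ _))) => /allP H.
      by have := H m; rewrite /= mem_head mem_comp => /(_ isT).
    apply/hasP; exists x; first exact: mem_head.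
    apply: H; rewrite /= inE mem_cat; apply/orP; right; apply/orP; right.
    by apply/flattenP; exists (x :: c); rewrite ?mem_head.
  - apply/allP => c cp; apply/hasPn => x xc; apply/negP => /(subsetP C0C); apply/negP.
    apply: mem_Cp_r => //; rewrite /= inE mem_cat; apply/orP; right; apply/orP; right.
    by apply/flattenP; exists c.
have sC0 : s \notin C0.
  apply/negP => sC0; case/negP: nt; apply/transwP => D cD.
  have smD : (s \in D) = (m \in D).
    have /compP H := sC0; apply/idP/idP; last exact: H.
    by apply: contraLR => mD; have := H (~: D); rewrite clwC !inE; apply.
  by have /transwP := t; apply; rewrite clw_rcons cD /= smD eqxx.
have C0E x : x \in b -> (x \in C0) = (x \in Cp p).
  rewrite (mem_b _ ps) => /orP[] xl.
    rewrite (mem_Cp_l ps xl); move: xl; rewrite /= -cat_cons mem_cat => /orP[xc|].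
      by rewrite (comp_cycle _ xc (mem_head _ _)) ?mem_head // mem_comp.
    case/flattenP => c cp xc; have /hasP[y yc yC] := P1 _ cp.
    by rewrite (comp_cycle (c := c) _ xc yc) // !inE (splits_mem ps) ?orbT // cp.
  rewrite (negbTE (mem_Cp_r ps xl)); move: xl; rewrite /= -cat_cons mem_cat => /orP[xc|].
    by rewrite (comp_cycle _ xc (mem_head _ _)) ?(negbTE sC0) // !inE eqxx orbT.
  case/flattenP => c cp xc; have /hasPn H := P2 _ cp.
  by apply/negbTE; apply: H.
have cC : clw w (Cp p).
  apply/allP => q qw; have /andP[q1 q2] := wb qw.
  by rewrite -!C0E // (eqP (allP (clw_comp w m) _ qw)).
split=> //; apply/transwP => D; rewrite clw_wC ?clwC // => cD.
  have lC x : x \in flatten (c1' :: p.1) -> x \in C0.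
    by move=> xl; rewrite C0E ?(mem_b _ ps) ?xl // (mem_Cp_l ps xl).
  case mD: (m \in D); [right | left]; apply/allP => x /lC /compP H.
    by have := H _ cD; rewrite !in_setI ?in_setC mD mC => /(_ isT)/andP[].
  have cD' : clw w (~: D :&: Cp p) by rewrite -clw_wC // clwC clw_wC.
  by have := H _ cD'; rewrite !in_setI ?in_setC mD mC => /(_ isT)/andP[].
(* A closed part of the side of [s] that contains [s], together with the whole side of [m], is
   closed under the last letter too. *)
have key E : clw w (E :&: ~: Cp p) -> s \in E ->
    forall x, x \in flatten (c2' :: p.2) -> x \in E.
  move=> cE sE x xl.
  have : clw (rcons w (s, m)) (Cp p :|: (E :&: ~: Cp p)).
    by rewrite clw_rcons clwU //= !in_setU !in_setI !in_setC sE mC sC orbT.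
  have /transwP H := t; case/H => /allP H'.
    by have := H' m mb; rewrite /= in_setU mC.
  have := H' x; rewrite (mem_b _ ps) xl orbT => /(_ isT) /=.
  by rewrite in_setU in_setI => /orP[|/andP[]//]; rewrite (negbTE (mem_Cp_r ps xl)).
case sD: (s \in D); [right | left]; apply/allP => x xl.
  exact: key cD sD x xl.
have cD' : clw w (~: D :&: ~: Cp p).
  have cC' : clw w (~: Cp p) by rewrite clwC.
  by rewrite -(clw_wC _ cC') clwC (clw_wC _ cC').
by have := key _ cD' _ x xl; rewrite !in_setC sD; apply.
Qed.

Lemma sum_Q : \sum_(p <- splits cs) Q p = transw (rcons w (s, m)) b && ~~ transw w b.
Proof.
rewrite (eq_big_seq (fun p => (transw (rcons w (s, m)) b && ~~ transw w b) *
   (all P p.1 && all (predC P) p.2))); last first.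
  by move=> p ps; rewrite Q_trans // mulnb -andbA.
by rewrite -big_distrr /= sum_splits_pred muln1.
Qed.

End Split.

Lemma fcycle_eq_in (f g : {perm X}) c : {in c, f =1 g} -> fcycle f c = fcycle g c.
Proof.
move=> E; apply: (eq_in_cycle (P := mem c)); last by apply/allP.
by move=> x y xc _ /=; rewrite E.
Qed.

Lemma cycw_wC w C cs : clw w C -> {subset flatten cs <= C} ->
  cycw (prodw w) cs = cycw (prodw (wC w C)) cs.
Proof.
move=> cC sC; apply: eq_in_all => c ccs; apply: fcycle_eq_in => x xc.
by apply: prodw_wC => //; apply: sC; apply/flattenP; exists c.
Qed.

Lemma sum_split m s c1 c2 cs b r : uniq b ->
  perm_eq b (flatten [:: m :: c1, s :: c2 & cs]) -> all (fun c => c != [::]) cs ->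
  \sum_(w <- mon b r)
     (cycw (prodw w) [:: m :: c1, s :: c2 & cs] && transw (rcons w (s, m)) b) =
  cnt [:: m :: c1, s :: c2 & cs] r +
  \sum_(p <- splits cs) \sum_(i < r.+1)
     cnt ((m :: c1) :: p.1) i * cnt ((s :: c2) :: p.2) (r - i).
Proof.
move=> Ub pb nz; set c1' := m :: c1; set c2' := s :: c2.
rewrite -(cntb_perm r Ub pb (perm_refl _)) /cntb.
pose Cp (p : seq (seq X) * seq (seq X)) := [set x in flatten (c1' :: p.1)].
pose Q w (p : seq (seq X) * seq (seq X)) :=
  [&& clw w (Cp p), transw (wC w (Cp p)) (flatten (c1' :: p.1))
    & transw (wC w (~: Cp p)) (flatten (c2' :: p.2))].
have -> : \sum_(w <- mon b r)
     (cycw (prodw w) [:: c1', c2' & cs] && transw (rcons w (s, m)) b) =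
   \sum_(w <- mon b r) (cycw (prodw w) [:: c1', c2' & cs] && transw w b) +
   \sum_(p <- splits cs) \sum_(w <- mon b r)
      (cycw (prodw w) [:: c1', c2' & cs] && Q w p).
  rewrite exchange_big -big_split; apply: eq_big_seq => w wm.
  case cyc: (cycw _ _) => /=; last by rewrite big1.
  rewrite (sum_Q Ub pb (fun p => mon_letters wm) cyc nz).
  have := @transw_rconsW w (s, m) b.
  by case: (transw w b) => [->//|_]; rewrite andbT.
congr (_ + _); apply: eq_big_seq => p ps.
pose F w1 w2 := (cycw (prodw w1) (c1' :: p.1) && transw w1 (flatten (c1' :: p.1))) *
  (cycw (prodw w2) (c2' :: p.2) && transw w2 (flatten (c2' :: p.2))).
have sC1 : {subset flatten (c1' :: p.1) <= Cp p} by move=> x xl; rewrite in_set.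
have sC2 : {subset flatten (c2' :: p.2) <= ~: Cp p}.
  by move=> x xl; rewrite in_setC (mem_Cp_r Ub pb ps).
have pcs : perm_eq ((c1' :: p.1) ++ (c2' :: p.2)) [:: c1', c2' & cs].
  rewrite /= perm_cons -[c2' :: p.2]cat1s perm_catCA /= perm_cons.
  exact: splits_perm.
have pb' := splits_flatten pb ps.
transitivity (\sum_(w <- mon b r | clw w (Cp p)) F (wC w (Cp p)) (wC w (~: Cp p))).
  rewrite [RHS]big_mkcond; apply: eq_bigr => w _; rewrite /Q /F.
  case cC: (clw w (Cp p)); last by rewrite andbF.
  rewrite /cycw -(eq_all_r (perm_mem pcs)) all_cat -!/(cycw _ _).
  rewrite (cycw_wC cC sC1) (@cycw_wC w (~: Cp p) (c2' :: p.2)) ?clwC //.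
  by rewrite mulnb; do !case: (cycw _ _); do !case: (transw _ _).
rewrite mon_split /mon2; apply: eq_bigr => i _.
have U12 : uniq (flatten (c1' :: p.1) ++ flatten (c2' :: p.2)).
  by rewrite -(perm_uniq pb').
have pf1 : perm_eq [seq x <- b | x \in Cp p] (flatten (c1' :: p.1)).
  rewrite (perm_trans (perm_filter _ pb')) // filter_cat.
  rewrite (all_filterP _); last by apply/allP.
  rewrite (eq_in_filter (a2 := pred0)) ?filter_pred0 ?cats0 // => x /sC2.
  by rewrite in_setC => /negbTE.
have pf2 : perm_eq [seq x <- b | x \in ~: Cp p] (flatten (c2' :: p.2)).
  rewrite (perm_trans (perm_filter _ pb')) // filter_cat.
  rewrite (eq_in_filter (a2 := pred0)) ?filter_pred0 => [|x /sC1].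
    by rewrite (all_filterP _) //; apply/allP.
  by rewrite in_setC => ->.
rewrite -(cntb_perm i _ pf1 (perm_refl _)) ?filter_uniq //.
rewrite -(cntb_perm (r - i) _ pf2 (perm_refl _)) ?filter_uniq //.
rewrite /cntb big_distrl /=; apply: eq_bigr => w1 _; rewrite big_distrr /=.
apply: eq_bigr => w2 _.
by rewrite (transw_eqi w1 (perm_mem pf1)) (transw_eqi w2 (perm_mem pf2)).
Qed.

Lemma transw_rcons_conn w s m c b : fcycle (prodw w) c -> s \in c -> m \in c ->
  transw (rcons w (s, m)) b = transw w b.
Proof.
move=> fc sc mc; apply/idP/idP; last exact: transw_rconsW.
move=> /transwP H; apply/transwP => C cC; apply: H; rewrite clw_rcons cC /=.
apply/eqP; apply: (cycle_stable _ fc) => // y; exact: prodw_stable.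
Qed.

(** Such a word leaves [m] isolated; its positive length provides another point. *)
Lemma not_transw_cons m b r w : m \notin b -> w \in mon b r.+1 -> transw w (m :: b) = false.
Proof.
case: b => [|x b]; first by rewrite /mon in_nil.
move=> mb wm; apply/negbTE/negP => /transwP /(_ [set m]) H.
have : clw w [set m].
  apply/allP => p pw; have /andP[h1 h2] := mon_letters wm pw.
  have nm y : y \in x :: b -> y == m = false.
    by move=> yb; apply: contraNF mb => /eqP <-.
  by rewrite !in_set1 !nm.
case/H => /=; rewrite !inE ?eqxx //= => /andP[/eqP xm _].
by move: mb; rewrite -xm mem_head.
Qed.

Theorem cnt_CN cs r : cs != [::] -> uniq (flatten cs) -> all (fun c => c != [::]) cs ->
  cnt cs r = CN r (map size cs).
Proof.
elim/ltn_ind: r cs => r IH [//|c0 cs] _ U /= /andP[]; case: c0 U => [//|m c] U _ nz.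
case: r IH => [|r] IH.
  rewrite /cnt /cntb mon0 big_seq1 /CN /= /prodw big_nil; congr (nat_of_bool _).
  rewrite eqseq_cons eqSS cycw_cons.
  case: c U => [|x c] U /=; last first.
    move: U; rewrite /= inE => /andP[]; rewrite perm1 negb_or => /andP[mx _] _.
    by rewrite (negbTE mx).
  rewrite perm1 eqxx /=; case: cs U nz => [|[//|x d] cs] U nz /=.
    apply/transwP => C _; case mC: (m \in C); [right | left]; by rewrite /= mC.
  rewrite andbC; apply/negbTE/negP => /andP[/transwP/(_ [set m] isT) H _].
  move: U; rewrite /= inE negb_or => /andP[/andP[mx _] _].
  by case: H => /=; rewrite !inE ?eqxx //= eq_sym (negbTE mx).
set b := flatten ((m :: c) :: cs).
have bE : b = m :: (c ++ flatten cs) by [].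
have mb : m \notin c ++ flatten cs by case/andP: U.
have /and3P[Uc /hasPn dis Ucs] :
  [&& uniq (m :: c), ~~ has [in m :: c] (flatten cs) & uniq (flatten cs)].
  by rewrite -cat_uniq.
have dis2 x d : x \in m :: c -> d \in cs -> x \notin d.
  move=> xc dcs; apply/negP => xd; have := dis x.
  by rewrite xc => /(_ _)/negP; apply => //; apply/flattenP; exists d.
rewrite CNS /= /cnt /cntb -/b bE monS big_cat /= big1_seq; last first.
  by move=> w /andP[_ wm]; rewrite (not_transw_cons mb wm) andbF.
(* The last letter is now [(s, m)]; the sum over [s] splits into the other points of the first
   cycle, which give cuts, and the points of the remaining cycles, which give joins. *)
rewrite add0n big_allpairs_dep /= -bE exchange_big big_cat /=; congr (_ + _).
  rewrite (big_nth m) big_mkord; apply: eq_bigr => k _.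
  set s := nth m c k.
  have cE : c = take k c ++ s :: drop k.+1 c by rewrite -drop_nth // cat_take_drop.
  have pb : perm_eq b (flatten [:: m :: take k c, s :: drop k.+1 c & cs]).
    by rewrite bE {1}cE /= -!catA.
  have Ux : uniq (m :: take k c ++ s :: drop k.+1 c) by rewrite -cE.
  have sc : s \in m :: c by rewrite inE mem_nth ?orbT.
  have E w : cycw (prodw (rcons w (s, m))) ((m :: c) :: cs) =
      cycw (prodw w) [:: m :: take k c, s :: drop k.+1 c & cs].
    rewrite prodw_rcons !cycw_cons {1}cE (cycle_tperm_split _ Ux).
    rewrite -mulgA tperm2 mulg1 -andbA; congr [&& _, _ & _].
    apply: eq_in_all => d dcs; rewrite [RHS](@cycle_tperm _ _ s m) //; first exact: dis2.
    by apply: dis2; rewrite ?mem_head.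
  under eq_bigr => w _ do rewrite E.
  rewrite sum_split //.
  have sz1 : size (m :: take k c) = k.+1 by rewrite /= size_takel // ltnW.
  have sz2 : size (s :: drop k.+1 c) = size c - k by rewrite /= size_drop subnSK.
  congr (_ + _).
    by rewrite IH ?map_cons ?sz1 ?sz2 // -(perm_uniq pb).
  rewrite splits_map big_map; apply: eq_big_seq => p ps; apply: eq_bigr => i _.
  have := splits_flatten pb ps => /perm_uniq; rewrite U cat_uniq.
  move=> /esym/and3P[U1 _ U2].
  have : all (fun c => c != [::]) (p.1 ++ p.2).
    by rewrite (eq_all_r (perm_mem (splits_perm ps))).
  rewrite all_cat => /andP[nz1 nz2].
  by rewrite !IH ?ltnS ?leq_subr ?leq_ord // ?map_cons ?sz1 ?sz2.
rewrite big_flatten_picks picks_map big_map; apply: eq_big_seq => -[d f] ps /=.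
have pcs := picks_perm ps; rewrite /= in pcs.
(* Every point [s] of [d] gives the same count, hence the factor [size d]. *)
rewrite (eq_big_seq (fun _ => CN r ((size c).+1 + size d :: map size f))).
  by rewrite big_const_seq iter_addn_0 count_predT mulnC.
move=> s /= sd.
have dcs : d \in cs by rewrite -(perm_mem pcs) mem_head.
case/splitPr: sd dcs pcs {ps} => d1 d2 dcs pcs.
set c' := m :: c ++ s :: d2 ++ d1.
have pd : perm_eq (s :: d2 ++ d1) (d1 ++ s :: d2) by rewrite -cat_cons perm_catC.
have pb : perm_eq b (flatten (c' :: f)).
  have : perm_eq b (flatten ((m :: c) :: (d1 ++ s :: d2) :: f)).
    by apply: perm_flatten; rewrite perm_cons perm_sym.
  move/perm_trans; apply; rewrite /c' /= perm_cons -!catA perm_cat2l.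
  by rewrite catA perm_cat2r perm_sym.
have Ub' : uniq (flatten (c' :: f)) by rewrite -(perm_uniq pb).
have Uc' : uniq c' by move: Ub'; rewrite -[flatten _]/(c' ++ flatten f) cat_uniq => /and3P[].
have csE g : cycw g cs = fcycle g (d1 ++ s :: d2) && cycw g f.
  by rewrite /cycw -(eq_all_r (perm_mem pcs)).
have rotE (g : {perm X}) : fcycle g (d1 ++ s :: d2) = fcycle g (s :: d2 ++ d1).
  by rewrite -(rot_cycle (size d1)) rot_size_cat.
have E w : cycw (prodw (rcons w (s, m))) ((m :: c) :: cs) = cycw (prodw w) (c' :: f).
  rewrite prodw_rcons !cycw_cons csE rotE (cycle_tperm_split _ Uc') -andbA.
  congr [&& _, _ & _]; apply: eq_in_all => e ef.
  have ecs : e \in cs by rewrite -(perm_mem pcs) inE ef orbT.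
  rewrite [RHS](@cycle_tperm _ _ s m) //; last by apply: dis2; rewrite ?mem_head.
  apply/negP => se; move: Ub'.
  have sc' : s \in c' by rewrite /c' inE mem_cat mem_head !orbT.
  rewrite -[flatten _]/(c' ++ flatten f) cat_uniq => /and3P[_ /hasPn H _].
  have := H s; rewrite sc' => /(_ _)/negP; apply => //.
  by apply/flattenP; exists e.
have -> : \sum_(w <- mon b r) (cycw (prodw (rcons w (s, m))) ((m :: c) :: cs) &&
     transw (rcons w (s, m)) b) = cnt (c' :: f) r.
  rewrite -(cntb_perm r U pb (perm_refl _)) /cntb; apply: eq_bigr => w _.
  rewrite E; congr (nat_of_bool _); case cyc: (cycw _ _) => //=.
  move: cyc; rewrite cycw_cons => /andP[fc _].
  apply: (transw_rcons_conn _ fc); first by rewrite /c' inE mem_cat mem_head !orbT.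
  by rewrite mem_head.
rewrite IH //; last first.
  have : all (fun c => c != [::]) ((d1 ++ s :: d2) :: f).
    by rewrite (eq_all_r (perm_mem pcs)).
  by rewrite /= => /andP[].
congr (CN r (_ :: _)).
by rewrite /c' /= size_cat (perm_size pd).
Qed.

End Comb2.

End LoopEquation.

(** * From Hurwitz numbers to connected loops at the identity *)

Module WalkCounting.
Import all_boot all_fingroup zify.zify Defs JucysMurphy LoopEquation.
Set Implicit Arguments.
Unset Strict Implicit.
Unset Printing Implicit Defensive.
Local Open Scope nat_scope.

Lemma parts_bnd_uniq f n m : uniq (parts_bnd f n m).
Proof.
elim: f n m => [|f IH] n m /=; case: eqP => // _.
apply: allpairs_uniq_dep; first exact: iota_uniq.
  by move=> k _; apply: IH.
by move=> [k p] [k' p'] _ _ /= [-> ->].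
Qed.

Lemma nseq1_parts f n m : n <= f -> (0 < m) || (n == 0) -> nseq n 1 \in parts_bnd f n m.
Proof.
elim: f n m => [|f IH] [|n] m //= nf; rewrite orbF => m0.
apply/flatten_mapP; exists 1; first by rewrite mem_iota /= add1n ltnS leq_min m0.
by rewrite mem_map => [|p q []//]; rewrite subn1; apply: IH.
Qed.

Lemma nseq1_partitions d : nseq d 1 \in partitions d.
Proof. by apply: nseq1_parts => //; case: d. Qed.

Lemma porbit1 (X : finType) (x : X) : porbit 1%g x = [set x].
Proof.
apply/setP => y; rewrite in_set1; apply/porbitP/eqP => [[i]|->].
  by rewrite expg1n perm1.
by exists 0; rewrite expg0 perm1.
Qed.

Lemma porbits1_card (X : finType) : #|porbits (1%g : {perm X})| = #|X|.
Proof.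
rewrite card_imset // => x y; rewrite !porbit1; exact: set1_inj.
Qed.

Lemma size_cycle_type d (s : {perm 'I_d}) : size (cycle_type s) = #|porbits s|.
Proof. by rewrite size_sort size_map cardE. Qed.

Lemma cycle_type1 d : cycle_type (1%g : {perm 'I_d}) = nseq d 1.
Proof.
have sz := size_cycle_type (1%g : {perm 'I_d}).
rewrite porbits1_card card_ord in sz; rewrite -[X in nseq X _]sz; apply/all_pred1P.
rewrite all_sort all_map; apply/allP => c; rewrite mem_enum => /imsetP[x _ ->] /=.
by rewrite porbit1 cards1.
Qed.

Lemma sum_uniq_sub (T : eqType) (f : T -> nat) (s1 s2 : seq T) :
  uniq s1 -> {subset s1 <= s2} -> \sum_(i <- s1) f i <= \sum_(i <- s2) f i.
Proof.
move=> U sub; apply: sub_le_big_seq => // [x y|i]; first exact: leq_addr.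
rewrite count_uniq_mem //; case i1: (i \in s1) => //=.
by rewrite -has_count has_pred1 sub.
Qed.

Lemma leq_sum_ord (f : nat -> nat) m n : m <= n -> \sum_(i < m) f i <= \sum_(i < n) f i.
Proof.
move=> mn; rewrite -(big_mkord predT) -(big_mkord predT f) /=.
by rewrite [leqRHS](@big_cat_nat _ _ _ m) //= leq_addr.
Qed.

Section Factor.
Variable X : finType.
Implicit Types (b : seq X) (rho : {perm X}).

(* If [rho] moves the largest point [m], then [rho * tperm (rho m) m] fixes [m] and has
   one more cycle. *)
Lemma smon_factor b rho : uniq b -> (forall x, x \notin b -> rho x = x) ->
  exists2 v, v \in smon b (size v) & prodw v = rho /\ size v + #|porbits rho| = #|X|.
Proof.
elim: b rho => [|m b IH] rho.
  move=> _ fix_rho; have -> : rho = 1%g by apply/permP => x; rewrite perm1 fix_rho.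
  by exists [::]; rewrite ?smon0 ?inE // /prodw big_nil porbits1_card.
move=> /= /andP[mb U] fix_rho.
have [rm|rm] := eqVneq (rho m) m.
  have [|v vb [pv sv]] := IH rho U.
    by move=> x xb; have [->//|xm] := eqVneq x m; apply: fix_rho; rewrite inE negb_or xm.
  exists v => //; case E: (size v) vb => [|k] vb; first by rewrite smon0 -(smon0 b).
  by rewrite smonS mem_cat vb.
set s := rho m in rm *.
have sb : s \in b.
  apply/negPn/negP => sb; have := fix_rho s; rewrite inE negb_or rm sb => /(_ isT) H.
  by move/perm_inj: H => sm; rewrite sm eqxx in rm.
have [|v vb [pv sv]] := IH (rho * tperm s m)%g U.
  move=> x xb; rewrite permM; have [->|xm] := eqVneq x m; first by rewrite tpermL.
  rewrite fix_rho ?inE ?negb_or ?xm // tpermD // eq_sym //.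
  by apply: contraNneq xb => ->.
exists (rcons v (s, m)).
  rewrite size_rcons smonS mem_cat; apply/orP; right.
  by apply/allpairsP; exists (v, s).
split; first by rewrite prodw_rcons pv -mulgA tperm2 mulg1.
rewrite size_rcons addSn -sv -addnS; congr (_ + _); apply/esym.
rewrite -porbitsV invMg tpermV.
have := porbits_mul_tperm rho^-1%g s m; rewrite /= porbitsV porbitV rm addn1.
by have := mem_porbit rho 1 m; rewrite expg1 -/s => ->; rewrite addn0.
Qed.

End Factor.

Section Walks.
Variable d : nat.
Implicit Types (b : seq 'I_d) (w : seq ('I_d * 'I_d)).

Lemma mem_mon b r w : pairwise (fun i j : 'I_d => j < i) b ->
  (w \in mon b r) = [&& size w == r,
    all (fun p => [&& p.1 \in b, p.2 \in b & p.1 < p.2]) w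
    & pairwise (fun p q : 'I_d * 'I_d => p.2 <= q.2) w].
Proof.
elim: b r w => [|m b IHb] r w.
  by case: r => [|r] _; case: w => [|p w] //=; rewrite !andbF.
move=> /= /andP[/allP mb sb].
have mNb : m \notin b by apply/negP => /mb; rewrite ltnn.
elim: r w => [|r IHr] w; first by rewrite mon0 inE; case: w.
rewrite monS mem_cat IHb //; case/lastP: w => [|w [s t]].
  by rewrite /=; apply/allpairsP => -[[w s]] /= [_ _]; case: w.
rewrite !size_rcons !all_rcons !pairwise_rcons eqSS /= !inE.
apply/orP/and3P => [[/and3P[sz /andP[/and3P[s1 t1 st] al] pw]|]|].
- split=> //; rewrite ?sz // s1 t1 st !orbT /=.
  by apply: sub_all al => p /and3P[h1 h2 h3]; rewrite !inE h1 h2 h3 !orbT.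
- case/allpairsP => -[w' s'] /= [w'm s'b /rcons_inj[-> -> ->]].
  move: w'm; rewrite IHr => /and3P[sz al pw]; split=> //.
    by rewrite s'b eqxx orbT (mb _ s'b).
  rewrite pw andbT; apply: sub_all al => p /and3P[_].
  by rewrite inE => /orP[/eqP ->//|/mb /ltnW].
move=> [sz /andP[/and3P[s1 t1 st] al] /andP[le pw]].
move: t1; case/orP => [/eqP tm|tb].
  right; apply/allpairsP; exists (w, s); rewrite /= tm; split=> //.
    by rewrite IHr sz al pw.
  by case/orP: s1 => [/eqP sm|//]; rewrite sm tm ltnn in st.
left; rewrite sz tb st le pw !andbT /=.
have sm (x y : 'I_d) : (x == m) || (x \in b) -> x < y -> y \in b -> x \in b.
  by case/orP => // /eqP -> my /mb /(ltn_trans my); rewrite ltnn.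
rewrite (sm _ _ s1 st tb) /=; apply/allP => p pw'.
have /and3P[p1 p2 p12] := allP al _ pw'; have ple := allP le _ pw'.
have p2b : p.2 \in b.
  move: p2; rewrite inE => /orP[/eqP pm|//].
  by have := leq_ltn_trans ple (mb _ tb); rewrite /= pm ltnn.
by rewrite p2b p12 (sm _ _ p1 p12 p2b).
Qed.

Lemma mon_uniq b r : uniq b -> uniq (mon b r).
Proof.
elim: b r => [|m b IHb] r; first by case: r.
move=> /= /andP[mb U]; elim: r => [//|r IHr]; rewrite monS cat_uniq IHb //=.
rewrite (allpairs_uniq IHr U) ?andbT; last first.
  by move=> [w s] [w' s'] _ _ /= /rcons_inj[-> ->].
apply/hasPn => v /allpairsP[[w s] /= [_ _ ->]]; apply/negP => /mon_letters H.
by have := H (s, m); rewrite mem_rcons mem_head => /(_ isT) /andP[_ /=]; rewrite (negbTE mb).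
Qed.

Definition bord : seq 'I_d := rev (enum 'I_d).

Lemma bord_uniq : uniq bord. Proof. by rewrite rev_uniq enum_uniq. Qed.
Lemma mem_bord x : x \in bord. Proof. by rewrite mem_rev mem_enum. Qed.
Lemma size_bord : size bord = d. Proof. by rewrite size_rev size_enum_ord. Qed.

Lemma bord_sorted : pairwise (fun i j : 'I_d => j < i) bord.
Proof.
rewrite -sorted_pairwise; last by move=> y x z /= yx zy; apply: ltn_trans zy yx.
rewrite /bord -[X in sorted X](_ : (fun i j : 'I_d => (fun i j : 'I_d => i < j) j i) = _) //.
rewrite rev_sorted.
have := iota_ltn_sorted 0 d; rewrite -val_enum_ord sorted_map.
by [].
Qed.

Definition wseq r (w : walk d r) : seq ('I_d * 'I_d) := [seq w i | i <- enum 'I_r].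

Lemma wseq_inj r : injective (@wseq r).
Proof.
move=> w w' E; apply/ffunP => i; have /eq_in_map := E; apply.
by rewrite mem_enum.
Qed.

Lemma wseq_mon r (w : walk d r) : (wseq w \in mon bord r) = is_walk w && monotone w.
Proof.
rewrite mem_mon ?bord_sorted // size_map size_enum_ord eqxx /=; congr (_ && _).
  rewrite all_map; apply/allP/forallP => [H i|H i _] /=.
    by have := H i; rewrite mem_enum => /(_ isT) /and3P[].
  by rewrite !mem_bord H.
apply/idP/forallP => [pw i|H].
  apply/forallP => j; apply/implyP; rewrite leq_eqVlt => /orP[/eqP/val_inj -> //|ij].
  have /(pairwiseP (w i)) := pw.
  rewrite size_map size_enum_ord => /(_ i j (ltn_ord i) (ltn_ord j) ij).
  have nthE (k : 'I_r) : nth (w i) (wseq w) k = w k.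
    by rewrite /wseq (nth_map i) ?size_enum_ord // nth_ord_enum.
  by rewrite !nthE.
rewrite pairwise_map -sorted_pairwise; last by move=> y x z /= ; apply: leq_trans.
apply: (@sub_sorted _ (fun i j : 'I_r => i < j)) => [i j ij|].
  by have /forallP/(_ j)/implyP := H i; apply; apply: ltnW.
by have := iota_ltn_sorted 0 r; rewrite -val_enum_ord sorted_map.
Qed.

Lemma walk_sum r (P : pred (seq ('I_d * 'I_d))) :
  \sum_(w : walk d r) [&& is_walk w, monotone w & P (wseq w)] =
  \sum_(v <- mon bord r) P v.
Proof.
transitivity (\sum_(v <- [seq v <- [seq wseq w | w : walk d r] | v \in mon bord r]) P v).
  rewrite big_filter [RHS]big_mkcond big_map big_enum /=; apply: eq_bigr => w _.
  by rewrite wseq_mon; case: (is_walk w); case: (monotone w).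
apply: perm_big; apply: uniq_perm; rewrite ?mon_uniq ?bord_uniq //.
  by rewrite filter_uniq // map_inj_uniq ?enum_uniq //; apply: wseq_inj.
move=> v; rewrite mem_filter andb_idr // => vm.
have sz : size v == r by move: vm; rewrite mem_mon ?bord_sorted // => /and3P[].
apply/mapP; exists [ffun i => tnth (Tuple sz) i]; first by rewrite mem_enum.
rewrite /wseq; under eq_map => i do rewrite ffunE.
by rewrite map_tnth_enum.
Qed.

Definition transitive_gen (rho sigma : {perm 'I_d}) (v : seq ('I_d * 'I_d)) :=
  [transitive <<([set rho; sigma] :|: [set tp p | p in v])>>%g, on [set: 'I_d] | 'P].

Lemma prodw_wseq r (w : walk d r) : prodw (wseq w) = (\prod_(i < r) transp w i)%g.
Proof. by rewrite /prodw big_map enumT /index_enum locked_withE. Qed.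

Lemma transitive_walkE r rho (w : walk d r) :
  transitive_walk rho w = transitive_gen rho (rho * prodw (wseq w))%g (wseq w).
Proof.
rewrite /transitive_walk /transitive_gen /endpoint prodw_wseq.
suff -> : [set transp w i | i : 'I_r] = [set tp p | p in wseq w] by [].
apply/setP => t; apply/imsetP/imsetP => [[i _ ->]|[p /mapP[i _ ->] ->]]; last by exists i.
by exists (w i) => //; apply/mapP; exists i; rewrite ?mem_enum.
Qed.

Lemma monHurwitzE g al be : monHurwitz d g al be =
  \sum_(rho : {perm 'I_d} | cycle_type rho == al)
    \sum_(v <- mon bord (r_g g al be))
      (transitive_gen rho (rho * prodw v)%g v && (cycle_type (rho * prodw v)%g == be)).
Proof.
rewrite /monHurwitz -sum1dep_card big_mkcond /=.
rewrite -(pair_bigA _ (fun (rho : {perm 'I_d}) (w : walk d (r_g g al be)) =>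
   if [&& cycle_type rho == al, is_walk w, monotone w,
   transitive_walk rho w & cycle_type (endpoint rho w) == be] then 1 else 0)) /=.
rewrite [RHS]big_mkcond; apply: eq_bigr => rho _ /=.
case: eqP => _ /=; last by rewrite big1.
rewrite -walk_sum; apply: eq_bigr => w _.
by rewrite transitive_walkE /endpoint -prodw_wseq; case: ifP.
Qed.

Lemma transw_transitive_gen (x0 : 'I_d) v rho sigma b :
  (forall x, x \in b) -> transw v b -> transitive_gen rho sigma v.
Proof.
move=> ball /transwP t; rewrite /transitive_gen.
set A := _ :|: _; pose G := <<A>>%G.
have oT x : orbit 'P G x = [set: 'I_d].
  apply/setP => y; rewrite in_setT.
  case: (t (orbit 'P G x)) => [|/allP/(_ x (ball x))|/allP/(_ y (ball y))] //=; last first.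
    by rewrite orbit_refl.
  apply/allP => p pv; apply/eqP.
  have tG : tp p \in G.
    by apply: mem_gen; rewrite in_setU; apply/orP; right; apply: imset_f.
  by rewrite -(orbit_actr _ x p.1 tG) /= apermE tpermL.
by apply/imsetP; exists x0; rewrite ?in_setT // -(oT x0).
Qed.

(** The hypotheses on [rho] and [sigma] hold once [v] contains factorisations of [rho] and of the
    inverse of [sigma], as a product of letters preserves every closed set. *)
Lemma transitive_gen_transw (v v2 : seq ('I_d * 'I_d)) rho sigma b :
  transitive_gen rho sigma v2 -> {subset v2 <= v} ->
  (forall C, clw v C -> rho \in 'N(C | 'P)%g) ->
  (forall C, clw v C -> sigma \in 'N(C | 'P)%g) -> transw v b.
Proof.
move=> t sub hr hs; apply/transwP => C cC.
rewrite /transitive_gen in t; set G := <<_>>%g in t.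
have GC : (G \subset 'N(C | 'P))%g.
  rewrite gen_subG; apply/subsetP => f; rewrite in_setU in_set2 => /orP[/orP[]/eqP ->|].
  - exact: hr.
  - exact: hs.
  case/imsetP => p /sub pv ->; apply/astabsP => x /=.
  by apply: tp_stable; apply/eqP; apply: (allP cC).
case: (pickP (mem C)) => [x xC|C0]; last first.
  by left; apply/allP => y _; rewrite /= -[y \in C]/(mem C y) C0.
right; apply/allP => y _ /=.
have [a aG ->] := atransP2 t (in_setT x) (in_setT y).
by have /astabsP -> := subsetP GC _ aG.
Qed.

Definition loops n := \sum_(v <- mon bord n) (prodw v == 1%g) && transw v bord.

Lemma loops_CN n : 0 < d -> loops n = CN n (nseq d 1).
Proof.
move=> d0; pose cs := [seq [:: x] | x <- bord].
have fl : flatten cs = bord by rewrite /cs; elim: bord => //= x b ->.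
have -> : nseq d 1 = map size cs.
  have -> : map size cs = nseq (size bord) 1.
    by rewrite /cs; elim: bord => //= x b ->.
  by rewrite size_bord.
rewrite -cnt_CN ?fl ?bord_uniq //; last first.
- by rewrite /cs; elim: bord.
- by rewrite -size_eq0 size_map size_bord -lt0n.
rewrite /cnt /cntb fl; apply: eq_bigr => v _; congr (nat_of_bool (_ && _)).
rewrite /cycw all_map; apply/eqP/allP => [-> x _|H] /=; first by rewrite perm1 eqxx.
apply/permP => x; have := H x; rewrite mem_bord perm1 => /(_ isT) /=.
by rewrite andbT => /eqP.
Qed.

(** Appending [(s, m)] twice, with [m] the largest point, keeps a loop monotone, closed and
    connected; it raises the genus by one. *)
Lemma loopsSS n : 1 < d -> loops n <= loops n.+2.
Proof.
move=> d1; rewrite /loops; have := size_bord; have := bord_uniq.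
case: bord => [|m [|s b]] /= U sz; try by rewrite -sz in d1.
set b' := s :: b.
have step k (P : pred (seq ('I_d * 'I_d))) :
    \sum_(v <- mon (m :: b') k) P (rcons v (s, m)) <= \sum_(v <- mon (m :: b') k.+1) P v.
  rewrite monS big_cat big_allpairs_dep /=; apply: leq_trans (leq_addl _ _).
  by apply: leq_sum => v _; rewrite /b' big_cons; apply: leq_addr.
apply: leq_trans (step _ (fun v => (prodw v == 1%g) && transw v (m :: b'))).
apply: leq_trans (step _ (fun v => (prodw (rcons v (s, m)) == 1%g) &&
   transw (rcons v (s, m)) (m :: b'))).
apply: leq_sum => v _; rewrite !prodw_rcons -mulgA tperm2 mulg1.
case: (_ == _) => //=; case t: (transw _ _) => //.
by rewrite lt0b !transw_rconsW.
Qed.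

(** A walk [v] from [rho] to [sigma] becomes the loop [e rho ++ v ++ e sigma^-1]. Minimality of the
    factorisations cancels the numbers of cycles in [r_g], so all these loops have the same length
    [n]. *)
Lemma Fcoef_le g : 0 < d -> Fcoef g d <= 4 ^ d * loops (2 * g + 2 * d - 2).
Proof.
move=> d0; set n := 2 * g + 2 * d - 2.
pose Y al be (rho sigma : {perm 'I_d}) :=
  \sum_(v <- mon bord (r_g g al be)) ((rho * prodw v)%g == sigma) && transitive_gen rho sigma v.
have H1 al be : monHurwitz d g al be <=
   \sum_(rho : {perm 'I_d}) \sum_(sigma : {perm 'I_d})
      (cycle_type rho == al) * ((cycle_type sigma == be) * Y al be rho sigma).
  rewrite monHurwitzE big_mkcond; apply: leq_sum => rho _.
  case: eqP => _; last by [].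
  under [leqRHS]eq_bigr => sigma _ do rewrite mul1n big_distrr /=.
  rewrite exchange_big /=; apply: leq_sum => v _.
  rewrite (bigD1 (rho * prodw v)%g) //= eqxx /= mulnb andbC; exact: leq_addr.
have H2 : Fcoef g d <= \sum_(rho : {perm 'I_d}) \sum_(sigma : {perm 'I_d})
    Y (cycle_type rho) (cycle_type sigma) rho sigma.
  apply: (@leq_trans (\sum_(al <- partitions d) \sum_(be <- partitions d)
     \sum_(rho : {perm 'I_d}) \sum_(sigma : {perm 'I_d})
      (cycle_type rho == al) * ((cycle_type sigma == be) * Y al be rho sigma))).
    by apply: leq_sum => al _; apply: leq_sum => be _; apply: H1.
  under eq_bigr => al _ do rewrite exchange_big.
  rewrite exchange_big; apply: leq_sum => rho _ /=.
  under eq_bigr => al _ do rewrite exchange_big.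
  rewrite exchange_big; apply: leq_sum => sigma _ /=.
  (* For an upper bound it is enough that a cycle type occurs at most once in [partitions d]. *)
  have pick1 (x : seq nat) (f : seq nat -> nat) :
      \sum_(al <- partitions d) (x == al) * f al <= f x.
    have [xp|xp] := boolP (x \in partitions d).
      rewrite (bigD1_seq x) ?parts_bnd_uniq //= eqxx mul1n big1 ?addn0 // => al.
      by rewrite eq_sym => /negbTE ->.
    rewrite big1_seq // => al /andP[_ alp]; case: eqP => // xal.
    by rewrite xal alp in xp.
  apply: leq_trans (pick1 (cycle_type rho) (fun al => Y al (cycle_type sigma) rho sigma)).
  apply: leq_sum => al _; rewrite -big_distrr leq_mul2l; apply/orP; right.
  exact: pick1.
apply: (leq_trans H2) => {H1 H2}.
have fac (rho : {perm 'I_d}) : exists v, (v \in smon bord (size v)) &&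
    ((prodw v == rho) && (size v + #|porbits rho| == d)).
  have [x|v vb [pv sv]] := smon_factor (rho := rho) bord_uniq; first by rewrite mem_bord.
  by exists v; rewrite vb pv sv card_ord !eqxx.
pose e rho := xchoose (fac rho).
have eP rho : [/\ e rho \in smon bord (size (e rho)), prodw (e rho) = rho
    & size (e rho) + #|porbits rho| = d].
  by have /and3P[h1 /eqP h2 /eqP h3] := xchooseP (fac rho).
have e_inj : injective e.
  by move=> r1 r2 E; have [_ <- _] := eP r1; have [_ <- _] := eP r2; rewrite E.
have elt rho : size (e rho) < d.
  have [_ _ sz] := eP rho.
  have : 0 < #|porbits rho|.
    by rewrite card_gt0; apply/set0Pn; exists (porbit rho (Ordinal d0)); apply: imset_f.
  by move: sz; lia.
pose F (st : state 'I_d) : nat := (st.1 == 1%g) &&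
  [forall C : {set 'I_d}, (C \in st.2) ==> (all [predC C] bord || all (mem C) bord)].
have FE v : F (stw v) = (prodw v == 1%g) && transw v bord.
  rewrite /F /=; congr (nat_of_bool (_ && _)).
  by apply: eq_forallb => C; rewrite inE.
pose H v1 v3 := \sum_(v2 <- mon bord (n - size v3 - size v1)) F (stw (v1 ++ v2 ++ v3)).
have YH rho sigma : Y (cycle_type rho) (cycle_type sigma) rho sigma <=
    H (e rho) (e sigma^-1%g).
  have [_ p1 s1] := eP rho; have [_ p3 s3] := eP sigma^-1%g.
  have -> : Y (cycle_type rho) (cycle_type sigma) rho sigma =
    \sum_(v <- mon bord (n - size (e sigma^-1%g) - size (e rho)))
       ((rho * prodw v)%g == sigma) && transitive_gen rho sigma v.
    rewrite /Y /r_g !size_cycle_type; congr (\sum_(v <- mon _ _) _).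
    by rewrite porbitsV in s3; rewrite /n; lia.
  apply: leq_sum => v _; rewrite FE; case: eqP => //= rs.
  case t: (transitive_gen _ _ _) => //; rewrite lt0b !prodw_cat p1 p3 mulgA rs mulgV eqxx /=.
  apply: (transitive_gen_transw _ t) => [p pv|C|C].
  - by rewrite !mem_cat pv orbT.
  - rewrite /clw !all_cat => /andP[cC _]; apply/astabsP => x /=.
    by rewrite apermE -{1}p1; apply: prodw_stable.
  rewrite /clw !all_cat => /and3P[_ _ cC]; rewrite -[sigma]invgK groupV.
  apply/astabsP => x /=.
  by rewrite apermE -{1}p3; apply: prodw_stable.
apply: (@leq_trans (\sum_(rho : {perm 'I_d}) \sum_(sigma : {perm 'I_d})
  H (e rho) (e sigma^-1%g))).
  by apply: leq_sum => rho _; apply: leq_sum => sigma _; apply: YH.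
pose L := flatten [seq smon bord a | a <- index_iota 0 d].
(* [e] is injective, so a sum over permutations is at most the sum over all strictly monotone words
   of fewer than [d] letters. *)
have LE (f : seq ('I_d * 'I_d) -> nat) :
    \sum_(rho : {perm 'I_d}) f (e rho) <= \sum_(a < d) \sum_(v <- smon bord a) f v.
  have -> : \sum_(a < d) \sum_(v <- smon bord a) f v = \sum_(v <- L) f v.
    by rewrite big_flatten big_map big_mkord.
  rewrite -big_enum -[X in X <= _](big_map e predT f); apply: sum_uniq_sub.
    by rewrite map_inj_uniq ?enum_uniq.
  move=> v /mapP[rho _ ->]; have [ev _ _] := eP rho.
  apply/flatten_mapP; exists (size (e rho)) => //.
  by rewrite mem_index_iota /= elt.
have size_smon b a v : v \in smon b a -> size v = a.
  elim: b a v => [|m b IHb] a v; first by case: a => //; rewrite inE => /eqP ->.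
  case: a => [|a]; first by rewrite smon0 inE => /eqP ->.
  rewrite smonS mem_cat => /orP[/IHb//|/allpairsP[[w s] /= [/IHb sw _ ->]]].
  by rewrite size_rcons sw.
rewrite /loops; under [X in _ <= _ * X]eq_bigr => v _ do rewrite -FE.
have := smon_mon_smon_le F n bord_uniq; rewrite size_bord; apply: leq_trans.
apply: (@leq_trans (\sum_(a < d) \sum_(v1 <- smon bord a) \sum_(c < d) \sum_(v3 <- smon bord c)
   H v1 v3)).
  apply: leq_trans (LE _); apply: leq_sum => rho _.
  rewrite (reindex_inj invg_inj) /=; under eq_bigr => s _ do rewrite invgK.
  exact: LE.
under eq_bigr => a _ do rewrite exchange_big.
rewrite exchange_big /=.
have dn : d <= n.+1 by rewrite /n; lia.
apply: (@leq_trans (\sum_(c < d) \sum_(a < (n - c).+1)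
     \sum_(w1 <- smon bord a) \sum_(w2 <- mon bord (n - c - a)) \sum_(w3 <- smon bord c)
      F (stw (w1 ++ w2 ++ w3)))); last first.
  exact: (leq_sum_ord (fun c => \sum_(a < (n - c).+1)
     \sum_(w1 <- smon bord a) \sum_(w2 <- mon bord (n - c - a)) \sum_(w3 <- smon bord c)
      F (stw (w1 ++ w2 ++ w3)))).
apply: leq_sum => c _.
have dn2 : d <= (n - c).+1 by have := ltn_ord c; rewrite /n; lia.
apply: (@leq_trans (\sum_(a < d)
     \sum_(w1 <- smon bord a) \sum_(w2 <- mon bord (n - c - a)) \sum_(w3 <- smon bord c)
      F (stw (w1 ++ w2 ++ w3)))); last first.
  exact: (leq_sum_ord (fun a =>
     \sum_(w1 <- smon bord a) \sum_(w2 <- mon bord (n - c - a)) \sum_(w3 <- smon bord c)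
      F (stw (w1 ++ w2 ++ w3)))).
apply: leq_sum => a _; rewrite big_seq [leqRHS]big_seq; apply: leq_sum => v1 v1m.
rewrite exchange_big /= big_seq [leqRHS]big_seq; apply: leq_sum => v3 v3m.
by rewrite /H (size_smon _ _ _ v1m) (size_smon _ _ _ v3m).
Qed.

(** Keep only the walks from the identity to itself; by [loopsSS] they are at least as numerous as
    in genus zero. *)
Lemma Fcoef_ge g : 1 < d -> CN (2 * d - 2) (nseq d 1) <= Fcoef g d.
Proof.
move=> d1; have d0 : 0 < d by apply: ltnW.
apply: (@leq_trans (loops (2 * g + 2 * d - 2))).
  rewrite -loops_CN //; have -> : 2 * g + 2 * d - 2 = 2 * d - 2 + g.*2 by lia.
  elim: g => [|g IH]; first by rewrite addn0.
  by rewrite doubleS !addnS; apply: leq_trans IH (loopsSS _ d1).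
rewrite /Fcoef (bigD1_seq (nseq d 1)) ?nseq1_partitions ?parts_bnd_uniq //=.
rewrite (bigD1_seq (nseq d 1)) ?nseq1_partitions ?parts_bnd_uniq //=.
apply: leq_trans (leq_addr _ _); apply: leq_trans (leq_addr _ _).
rewrite monHurwitzE (bigD1 1%g) ?cycle_type1 //=; apply: leq_trans (leq_addr _ _).
have -> : r_g g (nseq d 1) (nseq d 1) = 2 * g + 2 * d - 2.
  by rewrite /r_g !size_nseq; lia.
apply: leq_sum => v _; rewrite mul1g; case: eqP => //= ->.
case t: (transw _ _) => //; rewrite lt0b cycle_type1 eqxx andbT.
by apply: (transw_transitive_gen (Ordinal d0) _ _ _ t) => x; apply: mem_bord.
Qed.

End Walks.

Lemma Fcoef_le_CN g n : Fcoef g n.+1 <= 4 ^ n.+1 * CN (2 * n + 2 * g) (nseq n.+1 1).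
Proof.
have := Fcoef_le g (ltn0Sn n); rewrite loops_CN //.
by have -> : 2 * g + 2 * n.+1 - 2 = 2 * n + 2 * g by lia.
Qed.

Lemma Fcoef_ge_CN g n : 0 < n -> CN (2 * n) (nseq n.+1 1) <= Fcoef g n.+1.
Proof.
move=> n0; have := @Fcoef_ge n.+1 g n0.
by have -> : 2 * n.+1 - 2 = 2 * n by lia.
Qed.

End WalkCounting.

(** * Coefficients with many fixed points and their recursion *)

Module TopologicalBounds.
Import all_boot all_order all_algebra zify.zify algebra_tactics.ring.
Import algebra_tactics.lra LoopEquation.
Set Implicit Arguments.
Unset Strict Implicit.
Unset Printing Implicit Defensive.
Import Order.TTheory GRing.Theory Num.Theory.
Local Open Scope nat_scope.

Lemma sum_splits_nseq (F : seq nat * seq nat -> nat) A n :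
  \sum_(p <- splits (A ++ nseq n 1)) F p =
  \sum_(p <- splits A) \sum_(k < n.+1)
     'C(n, k) * F (p.1 ++ nseq k 1, p.2 ++ nseq (n - k) 1).
Proof.
elim: A F => [|x A IH] F; last by rewrite !big_splits_cons /= !IH.
rewrite big_seq1 /=; elim: n F => [|n IHn] F.
  by rewrite big_seq1 big_ord1 bin0 mul1n.
rewrite big_splits_cons !IHn /= [RHS]big_ord_recl /= bin0 mul1n.
under [X in _ = _ + X]eq_bigr => i _ do rewrite binS mulnDl subSS.
rewrite big_split /= [LHS]addnC addnA; congr (_ + _).
rewrite [in RHS]big_ord_recr /= bin_small // mul0n addn0.
rewrite big_ord_recl /= bin0 mul1n subn0; congr (_ + _).
by apply: eq_bigr => i _; rewrite /bump /= add1n -(subnSK (ltn_ord i)).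
Qed.

Lemma sum_picks_nseq (F : nat * seq nat -> nat) A n :
  \sum_(p <- picks (A ++ nseq n 1)) F p =
  \sum_(p <- picks A) F (p.1, p.2 ++ nseq n 1) + n * F (1, A ++ nseq n.-1 1).
Proof.
elim: A F => [|x A IH] F; last by rewrite !big_picks_cons IH addnA.
rewrite big_nil add0n /=; elim: n F => [|n IHn] F; first by rewrite big_nil.
by rewrite big_picks_cons IHn mulSn /=; case: n {IHn} => //; rewrite !mul0n.
Qed.

Lemma sum_picks_fst (A : seq nat) : \sum_(p <- picks A) p.1 = sumn A.
Proof. by elim: A => [|x A IH]; rewrite ?big_nil // big_picks_cons IH. Qed.

Lemma size_splits (A : seq nat) : size (splits A) = 2 ^ size A.
Proof. by elim: A => //= x A IH; rewrite size_cat !size_map IH expnS mul2n addnn. Qed.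

Lemma splits_sum_size (A : seq nat) (p : seq nat * seq nat) : p \in splits A ->
  sumn p.1 + sumn p.2 = sumn A /\ size p.1 + size p.2 = size A.
Proof.
move=> /splits_perm pp; split; last by rewrite -size_cat (perm_size pp).
by rewrite -sumn_cat; apply: perm_sumn.
Qed.

Lemma picks_sum_size (A : seq nat) (p : nat * seq nat) : p \in picks A ->
  p.1 + sumn p.2 = sumn A /\ (size p.2).+1 = size A.
Proof.
move=> /picks_perm pp; split; last by rewrite -(perm_size pp).
by rewrite -(perm_sumn pp).
Qed.

(** Nonnegativity of the genus in the Riemann-Hurwitz formula, read off the loop equation: each of
    its terms violates the same inequality. *)
Lemma CN_vanish r al : r + 2 < sumn al + size al -> CN r al = 0.
Proof.
elim/ltn_ind: r al => -[|r] IH al.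
  by rewrite CN0; case: eqP => [->|].
move=> lt; rewrite CNS /CNstep; case: al lt => // a A /= lt.
rewrite big1 ?add0n => [|k _].
  rewrite big1_seq // => -[p1 p2] /andP[_ /picks_sum_size[/= sp zp]].
  by rewrite IH ?muln0 //=; lia.
have ka := ltn_ord k; rewrite IH //=; last by lia.
rewrite big1_seq // => -[p1 p2] /andP[_ /splits_sum_size[/= sp zp]].
rewrite big1 // => i _; have ir := ltn_ord i.
have [h1|h1] := ltnP (i + 2) (k.+1 + sumn p1 + (@size nat p1).+1).
  by rewrite IH.
by rewrite [X in _ * X]IH ?muln0 //=; lia.
Qed.

Section Coefficients.
Variable R : numFieldType.
Local Open Scope ring_scope.

(* [G] is twice the genus, [A] lists the marked cycle lengths and [n] counts the other
   cycles, all of length one; the index of [CN] is then given by Riemann-Hurwitz. *)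
Definition ct G A n : R :=
  (CN (sumn A + size A + 2 * n + G - 2) (A ++ nseq n 1%N))%:R / n`!%:R.

Lemma ct_ge0 G A n : 0 <= ct G A n.
Proof. by rewrite divr_ge0. Qed.

Lemma sumn_nseq1 n : sumn (nseq n 1%N) = n.
Proof. by rewrite sumn_nseq mul1n. Qed.

(* Only the splittings of [r] compatible with nonnegative genera survive. *)
Lemma sum_CN_genus r G T1 T2 al be : (T1 + T2 + G = r)%N ->
  (sumn al + size al = T1 + 2)%N -> (sumn be + size be = T2 + 2)%N ->
  (\sum_(i < r.+1) CN i al * CN (r - i) be =
   \sum_(h < G.+1) CN (T1 + h) al * CN (T2 + (G - h)) be)%N.
Proof.
move=> Er s1 s2.
rewrite -(big_mkord predT (fun i => CN i al * CN (r - i) be)%N).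
rewrite (@big_cat_nat _ _ _ T1) //=; last by lia.
rewrite big_nat_cond big1 ?add0n => [|i]; last first.
  by rewrite andbT => /andP[_ iT]; rewrite CN_vanish ?mul0n //; lia.
rewrite (@big_cat_nat _ _ _ (T1 + G).+1) //=; [|lia|lia].
rewrite [X in (_ + X)%N]big_nat_cond [X in (_ + X)%N]big1 ?addn0 => [|i]; last first.
  by rewrite andbT => /andP[h1 h2]; rewrite [X in (_ * X)%N]CN_vanish ?muln0 //; lia.
rewrite -{1}[T1]add0n -addnS big_addn addKn big_mkord.
apply: eq_bigr => h _; rewrite addnC; congr (_ * CN _ _)%N; have := ltn_ord h; lia.
Qed.

(** Division by [n!] turns the binomials of [sum_splits_nseq] into a Cauchy product and cancels the
    factor [n] when a fixed point joins the first cycle. The term in [G - 2] is a cut that leaves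
    the word connected. *)
Lemma ct_rec G a A n :
  ct G (a.+1 :: A) n =
  [&& G == 0, a == 0, A == [::] & n == 0]%N%:R +
  \sum_(k < a) ((if (1 < G)%N then ct (G - 2) [:: k.+1, (a - k)%N & A] n else 0) +
     \sum_(p <- splits A) \sum_(l < n.+1) \sum_(h < G.+1)
        ct h (k.+1 :: p.1) l * ct (G - h) ((a - k)%N :: p.2) (n - l)) +
  (if n is n'.+1 then ct G (a.+2 :: A) n' else 0) +
  \sum_(p <- picks A) p.1%:R * ct G ((a.+1 + p.1)%N :: p.2) n.
Proof.
have fn0 k : (k`!)%:R != 0 :> R by rewrite pnatr_eq0 -lt0n fact_gt0.
(* This sum is the number of steps; it vanishes only for the empty walk on one point. *)
case E : (a + (sumn A + size A) + 2 * n + G)%N => [|r].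
  have [a0 A0 n0 G0] : [/\ a = 0, size A = 0, n = 0 & G = 0]%N by split; lia.
  move/size0nil: A0 E => -> _; rewrite a0 n0 G0 big_ord0 big_nil !addr0.
  by rewrite /ct /= divr1.
have -> : [&& G == 0, a == 0, A == [::] & n == 0]%N = false.
  by apply/negP => /and4P[/eqP G0 /eqP a0 /eqP A0 /eqP n0]; move: E; rewrite G0 a0 A0 n0.
rewrite add0r {1}/ct.
have -> : (sumn (a.+1 :: A) + size (a.+1 :: A) + 2 * n + G - 2 = r.+1)%N by rewrite /=; lia.
rewrite CNS /CNstep /= natrD mulrDl -addrA; congr (_ + _); last first.
  rewrite sum_picks_nseq natrD mulrDl [RHS]addrC; congr (_ + _); last first.
    case: n E => [|n] E; first by rewrite mul0n mul0r.
    rewrite /ct /= factS !natrM addn1.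
    have -> : (a.+2 + sumn A + (size A).+1 + 2 * n + G - 2 = r)%N by lia.
    by rewrite mul1r -mulf_div divff ?mul1r // pnatr_eq0.
  rewrite natr_sum mulr_suml; apply: eq_big_seq => -[p1 p2] /picks_sum_size[/= sp zp].
  rewrite natrM -mulrA /ct /=; congr (_ * ((CN _ _)%:R / _)); lia.
rewrite natr_sum mulr_suml; apply: eq_bigr => k _; have ka := ltn_ord k.
rewrite natrD mulrDl; congr (_ + _).
  case: ifP => G1.
    rewrite /ct /=; congr ((CN _ _)%:R / _); lia.
  by rewrite CN_vanish ?mul0r //= sumn_cat size_cat sumn_nseq1 size_nseq; lia.
rewrite sum_splits_nseq natr_sum mulr_suml; apply: eq_big_seq => -[p1 p2] /splits_sum_size[/= sp zp].
rewrite natr_sum mulr_suml; apply: eq_bigr => l _; have ln := ltn_ord l.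
rewrite (@sum_CN_genus r G (k + (sumn p1 + @size nat p1) + 2 * l)
   ((a - k).-1 + (sumn p2 + @size nat p2) + 2 * (n - l))%N) /=; first last.
- by rewrite sumn_cat size_cat sumn_nseq1 size_nseq; lia.
- by rewrite sumn_cat size_cat sumn_nseq1 size_nseq; lia.
- by lia.
rewrite natrM natr_sum mulr_sumr mulr_suml; apply: eq_bigr => h _; have hG := ltn_ord h.
rewrite natrM /ct /=.
have -> : (k.+1 + sumn p1 + (@size nat p1).+1 + 2 * l + h - 2 =
  k + (sumn p1 + @size nat p1) + 2 * l + h)%N by lia.
have -> : (a - k + sumn p2 + (@size nat p2).+1 + 2 * (n - l) + (G - h) - 2 =
  (a - k).-1 + (sumn p2 + @size nat p2) + 2 * (n - l) + (G - h))%N by lia.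
have -> : 'C(n, l)%:R = n`!%:R / (l`!%:R * (n - l)`!%:R) :> R.
  by rewrite -(bin_fact (n := n) (m := l)) 1?natrM ?natrM ?mulfK ?mulf_neq0 // -ltnS.
field.
by rewrite !fn0.
Qed.

End Coefficients.

Local Open Scope ring_scope.

Local Ltac nlia :=
  repeat match goal with
  | H : is_true (Order.le _ _) |- _ => clear H
  | H : is_true (Order.lt _ _) |- _ => clear H
  end;
  repeat match goal with x := _ |- _ => clear x end; lia.

Lemma ler_sum_ord (R : numDomainType) (f : nat -> R) m n : (forall i, 0 <= f i) -> (m <= n)%N ->
  \sum_(i < m) f i <= \sum_(i < n) f i.
Proof.
move=> f0 mn; rewrite -(big_mkord predT f) -(big_mkord predT f) /=.
by rewrite [leRHS](@big_cat_nat _ _ _ m) //= lerDl sumr_ge0.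
Qed.

Lemma ler_sum_triangle (R : numDomainType) (g : nat -> nat -> R) K :
  (forall i j, 0 <= g i j) ->
  \sum_(n < K) \sum_(l < n.+1) g l (n - l)%N <= \sum_(l < K) \sum_(m < K) g l m.
Proof.
move=> g0.
have -> : \sum_(n < K) \sum_(l < n.+1) g l (n - l)%N =
    \sum_(l < K) \sum_(n < K | (l <= n)%N) g l (n - l)%N.
  transitivity (\sum_(n < K) \sum_(l < K | (l <= n)%N) g l (n - l)%N).
    apply: eq_bigr => n _; rewrite (big_ord_widen_cond K predT (fun l => g l (n - l)%N)) //.
  by rewrite (exchange_big_dep predT).
apply: ler_sum => l _.
rewrite -(big_mkord (fun n => (l <= n)%N) (fun n => g l (n - l)%N)).
rewrite (@big_cat_nat _ _ _ l) //=; last exact: ltnW.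
rewrite big_nat_cond big_pred0 ?add0r => [|i]; last by lia.
rewrite -{1}[val l]add0n big_addn.
rewrite (eq_big (fun=> true) (fun i => g l i)); first last.
- by move=> i _; rewrite addnK.
- by move=> i; rewrite leq_addl.
by rewrite big_mkord; apply: (ler_sum_ord (f := g l)) => //; apply: leq_subr.
Qed.

(** * Catalan numbers *)

Section Catalan.
Variable R : realFieldType.

Fixpoint catalan n : R := if n is k.+1 then catalan k * (4 * k + 2)%N%:R / k.+2%:R else 1.

Lemma catalanS n : n.+2%:R * catalan n.+1 = (4 * n + 2)%N%:R * catalan n.
Proof. by rewrite /= mulrC divfK ?pnatr_eq0 // mulrC. Qed.

Lemma catalan_gt0 n : 0 < catalan n.
Proof. by elim: n => //= n IH; rewrite divr_gt0 ?mulr_gt0 // ltr0n; lia. Qed.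

Arguments catalan : simpl never.

Lemma catalan0 : catalan 0 = 1. Proof. by []. Qed.

Lemma catalan_le4 n : catalan n.+1 <= 4 * catalan n.
Proof.
have c0 := catalan_gt0 n; have n0 : 0 < n.+2%:R :> R by rewrite ltr0n.
rewrite -(ler_pM2l n0) catalanS mulrA ler_pM2r // -natrM ler_nat; lia.
Qed.

(** Symmetrising the weight [i + 1] produces the factor [n + 3], while [catalanS] applied to one
    weighted factor reduces to the previous convolution. *)
Lemma catalan_conv n : \sum_(i < n.+1) catalan i * catalan (n - i) = catalan n.+1.
Proof.
elim: n => [|n IH]; first by rewrite big_ord1 /catalan /=; field.
pose S := \sum_(i < n.+2) catalan i * catalan (n.+1 - i).
have E1 : (n.+3)%:R * S = 2 * \sum_(i < n.+2) i.+1%:R * (catalan i * catalan (n.+1 - i)).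
  have rev : \sum_(i < n.+2) i.+1%:R * (catalan i * catalan (n.+1 - i)) =
      \sum_(i < n.+2) (n.+1 - i).+1%:R * (catalan i * catalan (n.+1 - i)).
    rewrite (reindex_inj rev_ord_inj) /=; apply: eq_bigr => i _.
    have ile : (i <= n.+1)%N by rewrite -ltnS.
    by rewrite subSS subKn // [catalan i * _]mulrC.
  rewrite [RHS]mulr_natl [RHS]mulr2n {2}rev -big_split /S mulr_sumr; apply: eq_bigr => i _ /=.
  rewrite -mulrDl -natrD; congr (_%:R * _); have := ltn_ord i; lia.
have E2 : \sum_(i < n.+2) i.+1%:R * (catalan i * catalan (n.+1 - i)) = (2 * n + 3)%N%:R * catalan n.+1.
  rewrite big_ord_recl /= subn0 catalan0 !mul1r.
  have -> : \sum_(i < n.+1) (bump 0 i).+1%:R * (catalan (bump 0 i) * catalan (n.+1 - bump 0 i)) =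
     \sum_(i < n.+1) (4 * i + 2)%N%:R * (catalan i * catalan (n - i)).
    apply: eq_bigr => i _; rewrite /bump add1n subSS.
    by rewrite mulrA catalanS mulrA.
  have -> : \sum_(i < n.+1) (4 * i + 2)%N%:R * (catalan i * catalan (n - i)) =
     (2 * n + 2)%N%:R * catalan n.+1.
    have rev : \sum_(i < n.+1) (4 * i + 2)%N%:R * (catalan i * catalan (n - i)) =
      \sum_(i < n.+1) (4 * (n - i) + 2)%N%:R * (catalan i * catalan (n - i)).
      rewrite (reindex_inj rev_ord_inj) /=; apply: eq_bigr => i _.
      have ile : (i <= n)%N by rewrite -ltnS.
      by rewrite subSS subKn // [catalan i * _]mulrC.
    have two0 : 2%:R != 0 :> R by rewrite pnatr_eq0.
    apply: (mulfI two0); rewrite [LHS]mulr_natl [LHS]mulr2n {2}rev -big_split /=.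
    rewrite mulrA -IH mulr_sumr; apply: eq_bigr => i _.
    rewrite -mulrDl -natrM -natrD; congr (_%:R * _); have := ltn_ord i; lia.
  by ring.
have n0 : n.+3%:R != 0 :> R by rewrite pnatr_eq0.
apply: (mulfI n0); rewrite -/S E1 E2 catalanS mulrA -natrM; congr (_%:R * _); lia.
Qed.

Definition csum (w : R) M := \sum_(i < M) catalan i * w ^+ i.

(** The value [c = (1 - v)^-1] solves [c = 1 + w c^2] for [w = v (1 - v)], and the partial sums stay
    below it by induction. *)
Lemma csum_le v M : 0 <= v -> v < 1 -> csum (v * (1 - v)) M <= (1 - v)^-1.
Proof.
move=> v0 v1; set w := v * (1 - v); have w0 : 0 <= w by rewrite mulr_ge0 //; lra.
have u0 : 0 < 1 - v by lra.
have c0 N : 0 <= csum w N.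
  by apply: sumr_ge0 => i _; rewrite mulr_ge0 ?exprn_ge0 // ltW ?catalan_gt0.
elim: M => [|M IH]; first by rewrite /csum big_ord0 invr_ge0 ltW.
rewrite /csum big_ord_recl /= expr0 mulr1 catalan0.
have -> : \sum_(i < M) catalan (bump 0 i) * w ^+ bump 0 i =
    w * \sum_(i < M) \sum_(k < i.+1) (catalan k * w ^+ k) * (catalan (i - k) * w ^+ (i - k)).
  rewrite mulr_sumr; apply: eq_bigr => i _; rewrite /bump add1n -catalan_conv exprS mulrCA.
  congr (_ * _); rewrite mulr_suml; apply: eq_bigr => k _.
  have -> : w ^+ i = w ^+ k * w ^+ (i - k) by rewrite -exprD subnKC // -ltnS.
  by rewrite mulrACA.
have le2 : \sum_(i < M) \sum_(k < i.+1) (catalan k * w ^+ k) * (catalan (i - k) * w ^+ (i - k)) <=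
    csum w M * csum w M.
  apply: (le_trans (ler_sum_triangle (g := fun k l => (catalan k * w ^+ k) * (catalan l * w ^+ l)) _ _)).
    by move=> k l; rewrite !mulr_ge0 ?exprn_ge0 // ltW ?catalan_gt0.
  by rewrite /csum mulr_suml; apply: ler_sum => l _; rewrite mulr_sumr.
apply: (@le_trans _ _ (1 + w * ((1 - v)^-1 * (1 - v)^-1))).
  by rewrite lerD2l ler_wpM2l //; apply: (le_trans le2); rewrite ler_pM.
have -> : 1 + w * ((1 - v)^-1 * (1 - v)^-1) = (1 - v)^-1; last by [].
by rewrite /w; field; lra.
Qed.

End Catalan.

Arguments catalan : simpl never.

(** * The planar solution and geometric bounds in every topology *)

Section Bounds.
Variables (R : realFieldType) (s : R).
Hypotheses (s1 : 1 / 3 < s) (s2 : s < 1 / 2).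

Local Ltac slra := move: (s1) (s2) => ? ?; lra.
Local Ltac snra := move: (s1) (s2) => ? ?; nra.

Let u : R := 2 * s ^+ 2 * (1 - 2 * s).
Let q : R := 4 * s ^+ 2.
Let kap : R := (1 - 2 * s) / (4 * s).

Lemma kap_gt0 : 0 < kap. Proof. by rewrite /kap divr_gt0 //; slra. Qed.
(** This is where [1/3 < s] enters. It yields [0 <= psi a], because Catalan numbers grow by at most
    [4], and the existence of a good [v], because [1/4] is the maximum of [v (1 - v)]. *)
Lemma kap_lt : kap < 1 / 4. Proof. by rewrite /kap ltr_pdivrMr; slra. Qed.
Lemma q_gt0 : 0 < q. Proof. by rewrite /q; snra. Qed.
Lemma u_gt0 : 0 < u. Proof. by rewrite /u !mulr_gt0 //; slra. Qed.

(* [psi a] bounds the generating function of planar walks whose marked cycle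
   has length [a + 1]; it is the exact solution of the planar loop equation. *)
Definition psi a := 2 * s * q^-1 ^+ a.+1 * (catalan R a - kap * catalan R a.+1).

Lemma psi_ge0 a : 0 <= psi a.
Proof.
have k1 := kap_lt; have k0 := kap_gt0; have c0 := catalan_gt0 R a; have c1 := catalan_le4 R a.
rewrite /psi mulr_ge0 //; last by snra.
by rewrite mulr_ge0 ?exprn_ge0 ?invr_ge0 ?(ltW q_gt0) //; slra.
Qed.

Lemma psi_conv a :
  (a == 0)%N%:R + \sum_(k < a) psi k * psi (a - k.+1) =
  q^-1 ^+ a * (catalan R a - 2 * kap * (catalan R a.+1 - catalan R a) +
                kap ^+ 2 * (catalan R a.+2 - 2 * catalan R a.+1)).
Proof.
case: a => [|a]; first by rewrite big_ord0 addr0 expr0 /catalan /=; field.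
rewrite add0r.
have E k : (k < a.+1)%N -> psi k * psi (a.+1 - k.+1) = q^-1 ^+ a.+1 *
   (catalan R k * catalan R (a - k) - kap * (catalan R k.+1 * catalan R (a - k)) -
    kap * (catalan R k * catalan R (a - k).+1) + kap ^+ 2 * (catalan R k.+1 * catalan R (a - k).+1)).
  move=> ka; rewrite subSS /psi.
  have -> : q^-1 ^+ a.+1 = 4 * s ^+ 2 * (q^-1 ^+ k.+1 * q^-1 ^+ (a - k).+1).
    rewrite -exprD; have -> : (k.+1 + (a - k).+1 = a.+2)%N by lia.
    by rewrite [q^-1 ^+ a.+2]exprS mulrA divff ?mul1r // gt_eqF ?q_gt0.
  by ring.
under eq_bigr => k _ do rewrite E //.
rewrite -mulr_sumr; congr (_ * _).
rewrite !big_split /= !sumrN -!mulr_sumr catalan_conv.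
have e1 : \sum_(i < a.+1) catalan R i.+1 * catalan R (a - i) = catalan R a.+2 - catalan R a.+1.
  rewrite -[catalan R a.+2]catalan_conv [in RHS]big_ord_recl /= catalan0 mul1r subn0 addrC addKr.
  by apply: eq_bigr => i _; rewrite /bump add1n subSS.
have e2 : \sum_(i < a.+1) catalan R i * catalan R (a - i).+1 = catalan R a.+2 - catalan R a.+1.
  rewrite -e1 (reindex_inj rev_ord_inj) /=; apply: eq_bigr => i _.
  by rewrite subSS subKn 1?mulrC // -ltnS.
have e3 : \sum_(i < a.+1) catalan R i.+1 * catalan R (a - i).+1 = catalan R a.+3 - 2 * catalan R a.+2.
  rewrite -(catalan_conv R a.+2) [in RHS]big_ord_recl [in RHS]big_ord_recr /= subn0 subnn.
  rewrite catalan0 mul1r mulr1.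
  rewrite /bump add1n.
  have -> : \sum_(i < a.+1) catalan R (1 + i) * catalan R (a.+2 - (1 + i)) =
    \sum_(i < a.+1) catalan R i.+1 * catalan R (a - i).+1.
    by apply: eq_bigr => i _; rewrite add1n subSS subSn // -ltnS.
  by ring.
by rewrite e1 e2 e3; ring.
Qed.

Lemma psi_rec a :
  psi a = (a == 0)%N%:R + \sum_(k < a) psi k * psi (a - k.+1) + u * psi a.+1.
Proof.
have s0 : s != 0 by rewrite gt_eqF //; slra.
(* The coefficients of three consecutive Catalan numbers agree because [1 + 2 kap = 1 / (2 s)] and
   [2 s u = kap q^2]. *)
rewrite psi_conv /psi !exprS /u /q /kap; set z := _ ^+ a; field.
by rewrite s0.
Qed.

(* At [x = (yv v)^-1 = q v (1 - v)], [Psiv v] bounds the generating function of [psi] and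
   [slack v] is [1 - 2 Psi(x) - u / x], the value at [x] of the linearised loop operator. *)
Definition good (v : R) := [&& 0 < v, v < 1 / 2 & kap < v * (1 - v)].
Definition yv (v : R) := (q * (v * (1 - v)))^-1.
Definition Psiv (v : R) := 2 * s * ((v * (1 - v) - kap) / (1 - v) + kap).
Definition slack (v : R) := 1 - 2 * Psiv v - u * yv v.

(** The slack factors: [1 - 2 v] is positive below the singularity [v = 1/2] of the Catalan series,
    and [v (1 - v) - kap] by the last condition in [good]. *)
Lemma slack_gt0 v : good v -> 0 < slack v.
Proof.
move=> /and3P[v0 v1 kv]; have s0 : s != 0 by rewrite gt_eqF //; slra.
have w0 : 0 < v * (1 - v) by rewrite mulr_gt0 //; slra.
have -> : slack v = 2 * s * (v * (1 - v) - kap) / (v * (1 - v)) * (1 - 2 * v).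
  rewrite /slack /Psiv /yv /u /q /kap; field.
  by rewrite s0 /=; apply/andP; split; rewrite ?gt_eqF //; slra.
by rewrite !mulr_gt0 ?invr_gt0 //; slra.
Qed.

Lemma yv_gt0 v : good v -> 0 < yv v.
Proof. by move=> /and3P[v0 v1 kv]; rewrite invr_gt0 !mulr_gt0 ?q_gt0 //; slra. Qed.

Lemma psi_sum_le v M : good v -> \sum_(a < M) psi a * (yv v)^-1 ^+ a.+1 <= Psiv v.
Proof.
move=> /and3P[v0 v1 kv]; set w := v * (1 - v); have q0 := q_gt0.
have w0 : 0 < w by rewrite mulr_gt0 //; slra.
have -> : \sum_(a < M) psi a * (yv v)^-1 ^+ a.+1 =
   2 * s * (w * csum w M - kap * (csum w M.+1 - 1)).
  have -> : csum w M.+1 - 1 = \sum_(a < M) catalan R a.+1 * w ^+ a.+1.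
    by rewrite /csum big_ord_recl /= expr0 catalan0 mulr1 addrC addKr.
  rewrite /csum !mulr_sumr -sumrB mulr_sumr.
  apply: eq_bigr => a _; rewrite /psi /yv invrK -/w exprMn.
  have : q^-1 ^+ a.+1 * q ^+ a.+1 = 1 by rewrite -exprMn mulVf ?gt_eqF // expr1n.
  move: (q^-1 ^+ a.+1) (q ^+ a.+1) => Q' Q QQ.
  rewrite -[RHS]mul1r -QQ exprS; ring.
have le1 : csum w M <= csum w M.+1.
  rewrite /csum big_ord_recr /= lerDl mulr_ge0 ?exprn_ge0 ?(ltW w0) //.
  exact/ltW/catalan_gt0.
have le2 : csum w M <= (1 - v)^-1 by apply: csum_le; slra.
have k0 := kap_gt0.
rewrite /Psiv ler_pM2l; last by slra.
have := ler_wpM2l (ltW k0) le1.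
have := ler_wpM2l (_ : 0 <= w - kap) le2; rewrite subr_ge0 (ltW kv) => /(_ isT).
rewrite -/w; slra.
Qed.

Lemma psi_le v a : good v -> psi a <= Psiv v * yv v ^+ a.+1.
Proof.
move=> gv; have y0 := yv_gt0 gv.
have := psi_sum_le a.+1 gv; rewrite big_ord_recr /= => le.
rewrite -ler_pdivrMr ?exprn_gt0 // -exprVn; apply: le_trans le; rewrite lerDr.
by apply: sumr_ge0 => i _; rewrite mulr_ge0 ?psi_ge0 // exprn_ge0 // invr_ge0 ltW.
Qed.

(** For nonempty [A] with positive entries the truncation keeps the walks of fewer than [N] steps,
    so one use of the loop equation passes from [N] to [N + 1]. *)
Definition tsum N G A : R :=
  \sum_(n < N.+1 | (sumn A + size A + 2 * n + G <= N.+1)%N) ct R G A n * u ^+ n.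

Lemma ctu_ge0 G A n : 0 <= ct R G A n * u ^+ n.
Proof. by rewrite mulr_ge0 ?ct_ge0 ?exprn_ge0 // ltW ?u_gt0. Qed.

Lemma tsum_ge0 N G A : 0 <= tsum N G A.
Proof. by apply: sumr_ge0 => n _; apply: ctu_ge0. Qed.

Lemma tsum_widen N G A K : (N.+1 <= K)%N -> tsum N G A =
  \sum_(n < K) (if (sumn A + size A + 2 * n + G <= N.+1)%N then ct R G A n * u ^+ n else 0).
Proof.
move=> NK; rewrite /tsum (big_ord_widen_cond K
  (fun n => (sumn A + size A + 2 * n + G <= N.+1)%N) (fun n => ct R G A n * u ^+ n)) //.
rewrite -big_mkcond; apply: eq_bigl => n; rewrite andb_idr //; lia.
Qed.

Lemma tsum0 G a A : tsum 0 G (a.+1 :: A) = 0.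
Proof. by rewrite /tsum big1 // => n /=; lia. Qed.

(** An inequality only, since a product of two truncated sums also contains pairs with too many
    steps in total. *)
Lemma tsum_step N G a A : tsum N.+1 G (a.+1 :: A) <=
  [&& G == 0, a == 0 & A == [::]]%N%:R +
  \sum_(k < a) ((if (1 < G)%N then tsum N (G - 2) [:: k.+1, (a - k)%N & A] else 0) +
     \sum_(p <- splits A) \sum_(h < G.+1)
        tsum N h (k.+1 :: p.1) * tsum N (G - h) ((a - k)%N :: p.2)) +
  u * tsum N G (a.+2 :: A) +
  \sum_(p <- picks A) p.1%:R * tsum N G ((a.+1 + p.1)%N :: p.2).
Proof.
have u0 := ltW u_gt0.
pose c n := (a + (sumn A + size A) + 2 * n + G <= N)%N.
have -> : tsum N.+1 G (a.+1 :: A) =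
    \sum_(n < N.+2) (if c n then ct R G (a.+1 :: A) n * u ^+ n else 0).
  rewrite (@tsum_widen _ _ _ N.+2) //; apply: eq_bigr => n _.
  by rewrite /c /=; congr (if _ then _ else _); lia.
pose x1 (n : nat) : R := [&& G == 0, a == 0, A == [::] & n == 0]%N%:R.
pose x2 k n : R := (if (1 < G)%N then ct R (G - 2) [:: k.+1, (a - k)%N & A] n else 0).
pose x3 k p h n : R := \sum_(l < n.+1) ct R h (k.+1 :: p.1) l * ct R (G - h) ((a - k)%N :: p.2) (n - l).
pose x4 n : R := (if n is n'.+1 then ct R G (a.+2 :: A) n' else 0).
pose x5 p n : R := p.1%:R * ct R G ((a.+1 + p.1)%N :: p.2) n.
pose trunc (f : nat -> R) : R := \sum_(n < N.+2) (if c n then f n * u ^+ n else 0).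
have truncD f g : trunc (fun n => f n + g n) = trunc f + trunc g.
  by rewrite /trunc -big_split; apply: eq_bigr => n _ /=; case: ifP; rewrite ?addr0 // mulrDl.
have trunc_sum I (r : seq I) (f : I -> nat -> R) :
    trunc (fun n => \sum_(i <- r) f i n) = \sum_(i <- r) trunc (f i).
  rewrite /trunc exchange_big; apply: eq_bigr => n _ /=; case: ifP => cn.
    by rewrite mulr_suml.
  by rewrite big1.
have -> : \sum_(n < N.+2) (if c n then ct R G (a.+1 :: A) n * u ^+ n else 0) =
  trunc x1 + \sum_(k < a) (trunc (x2 k) + \sum_(p <- splits A) \sum_(h < G.+1) trunc (x3 k p h)) +
  trunc x4 + \sum_(p <- picks A) trunc (x5 p).
  under [in RHS]eq_bigr => k _.
    under eq_bigr => p _ do rewrite -trunc_sum.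
    rewrite -trunc_sum -truncD; over.
  rewrite -!trunc_sum -!truncD /trunc; apply: eq_bigr => n _ /=; congr (if _ then _ * _ else _).
  rewrite ct_rec /x1 /x2 /x3 /x4 /x5; congr (_ + _ + _ + _); apply: eq_bigr => k _.
  by congr (_ + _); apply: eq_bigr => p _; rewrite exchange_big.
apply: lerD; first apply: lerD; first apply: lerD.
- rewrite /trunc big_ord_recl /= expr0 mulr1 big1 ?addr0 => [|n _].
    by rewrite /x1 eqxx andbT; case: ifP.
  by rewrite /x1 /= !andbF mul0r if_same.
- apply: ler_sum => k _; have ka := ltn_ord k; apply: lerD.
    rewrite /x2; case: ifP => G1; last by rewrite /trunc big1 // => n _; rewrite mul0r if_same.
    rewrite (@tsum_widen _ _ _ N.+2) // /trunc; apply: ler_sum => n _.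
    by rewrite /= le_eqVlt; apply/orP; left; apply/eqP; congr (if _ then _ else _); rewrite /c; lia.
  rewrite big_seq [leRHS]big_seq; apply: ler_sum => -[p1 p2] /splits_sum_size[/= sp zp].
  apply: ler_sum => h _; have hG := ltn_ord h.
  rewrite !(@tsum_widen _ _ _ N.+2) // mulr_suml.
  pose g l m : R := if c (l + m)%N then ct R h (k.+1 :: p1) l * u ^+ l *
     (ct R (G - h) ((a - k)%N :: p2) m * u ^+ m) else 0.
  apply: (@le_trans _ _ (\sum_(n < N.+2) \sum_(l < n.+1) g l (n - l)%N)).
    apply: ler_sum => n _; rewrite /x3 /g /=; case: ifP => cn; last first.
      by apply: sumr_ge0 => l _; rewrite subnKC ?cn // -ltnS.
    rewrite mulr_suml; apply: ler_sum => l _; have ln : (l <= n)%N by rewrite -ltnS.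
    by rewrite subnKC // cn [leRHS]mulrACA -exprD subnKC.
  apply: (le_trans (ler_sum_triangle _ _)) => [i j|].
    by rewrite /g; case: ifP => // _; rewrite mulr_ge0 ?ctu_ge0.
  apply: ler_sum => l _; rewrite mulr_sumr; apply: ler_sum => m _; rewrite /g.
  case: ifP => cl; last first.
    by rewrite mulr_ge0 //; case: ifP => // _; rewrite ctu_ge0.
  rewrite !ifT //= ; move: cl; rewrite /c; lia.
- rewrite (@tsum_widen _ _ _ N.+1) // /trunc big_ord_recl /= /x4 mul0r if_same add0r.
  rewrite mulr_sumr; apply: ler_sum => n _; rewrite /bump add1n /= exprS.
  have -> : (a.+2 + sumn A + (size A).+1 + 2 * n + G <= N.+1)%N = c n.+1 by rewrite /c; lia.
  by case: (c _); rewrite ?mulr0 // mulrCA.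
rewrite big_seq [leRHS]big_seq; apply: ler_sum => -[p1 p2] /picks_sum_size[/= sp zp].
rewrite (@tsum_widen _ _ _ N.+2) // /trunc mulr_sumr; apply: ler_sum => n _.
rewrite /x5 /=.
have -> : (a.+1 + p1 + sumn p2 + (@size nat p2).+1 + 2 * n + G <= N.+1)%N = c n.
  by rewrite /c; lia.
by case: (c n); rewrite ?mulr0 // -mulrA.
Qed.

(** Iterating the planar equation from zero never passes its nonnegative solution [psi]. *)
Lemma tsum_disk N a : tsum N 0 [:: a.+1] <= psi a.
Proof.
elim: N a => [|N IH] a; first by rewrite tsum0 psi_ge0.
apply: (le_trans (tsum_step _ _ _ _)); rewrite big_nil addr0 psi_rec andbT.
apply: lerD; last by rewrite ler_pM2l ?u_gt0.
apply: lerD => //; apply: ler_sum => k _; rewrite add0r big_seq1 big_ord1 /= subn0.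
have -> : (a - k = (a - k.+1).+1)%N by rewrite subnSK.
by apply: ler_pM; rewrite ?tsum_ge0.
Qed.

(** Moving [v] towards [1/2] lowers [yv]; the gap will absorb factors linear in the cycle
    lengths. *)
Lemma good_between v : good v -> exists2 v', good v' & yv v' < yv v.
Proof.
move=> /and3P[v0 v1 kv]; exists ((v + 1 / 2) / 2).
  by apply/and3P; split; [slra | slra | apply: (lt_trans kv); snra].
rewrite /yv ltf_pV2 ?posrE ?mulr_gt0 ?q_gt0 ?ltr_pM2l ?q_gt0 //; try slra.
snra.
Qed.

(** Bernoulli's inequality for the powers of [y / y']. *)
Lemma natr_exp_le (y' y : R) n : 0 < y' -> y' < y ->
  n%:R * y' ^+ n <= (y / y' - 1)^-1 * y ^+ n.
Proof.
move=> y0 yy; set t := y / y' - 1.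
have t0 : 0 < t by rewrite subr_gt0 ltr_pdivlMr // mul1r.
have -> : y = y' * (1 + t) by rewrite /t addrC subrK mulrC divfK // gt_eqF.
rewrite exprMn mulrCA mulrC ler_pM2l ?exprn_gt0 // mulrC ler_pdivlMr //.
have : 1 + n%:R * t <= (1 + t) ^+ n.
  elim: n => [|n IH]; first by rewrite mul0r addr0.
  rewrite exprS -natr1; apply: (@le_trans _ _ ((1 + t) * (1 + n%:R * t))).
    have : 0 <= n%:R * (t * t) by rewrite !mulr_ge0 // ltW.
    lra.
  by rewrite ler_pM2l //; lra.
lra.
Qed.

(* Positive slack at some [v] lets every topology be bounded by a geometric
   series in the cycle lengths, by induction on the complexity [G + size A]. *)
Lemma tsum_bound X v : good v -> exists2 K : R, 0 <= K & forall N G A,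
  (0 < size A)%N -> all (ltn 0) A -> (G + size A <= X.+1)%N ->
  tsum N G A <= K * yv v ^+ sumn A.
Proof.
elim: X v => [|X IH] v gv.
  have [/and3P[v0 v1 kv] y0] := (gv, yv_gt0 gv).
  exists (Psiv v).
    apply: le_trans (psi_sum_le 0 gv); by rewrite big_ord0.
  move=> N G [|[|a] [|b A]] // _ _ /=; rewrite ?addn1 ?addnS // ltnS leqn0 => /eqP ->.
  by rewrite addn0; apply: (le_trans (tsum_disk _ _)); apply: psi_le.
have [v' gv' yy] := good_between gv.
have [K' K'0 HK'] := IH v' gv'.
have [K1 K10 HK1] := IH v gv.
have y'0 := yv_gt0 gv'; have y0 := yv_gt0 gv; have sl := slack_gt0 gv.
set y := yv v in yy y0 HK1 *; set y' := yv v' in yy y'0 HK' *.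
have [c2 c2E] : exists c2, forall g z, (g <= X.+2)%N -> (z <= X.+2)%N -> (2 ^ z * g <= c2)%N.
  by exists (2 ^ X.+2 * X.+2)%N => g z gX zX; rewrite leq_mul // leq_exp2l.
(* [M] times the total length bounds the terms of smaller complexity at [y']; [D] trades that length
   for the passage from [y'] to [y], and dividing by the slack gives [Kn]. *)
pose M := K' + c2%:R * (K' * K').
have M0 : 0 <= M by rewrite addr_ge0 ?mulr_ge0.
pose D := (y / y' - 1)^-1.
have D0 : 0 <= D by rewrite invr_ge0 subr_ge0 ler_pdivlMr // mul1r ltW.
pose Kn : R := M * D / slack v.
have Kn0 : 0 <= Kn by rewrite /Kn divr_ge0 ?(ltW sl) // mulr_ge0.
exists (K1 + Kn); first exact: addr_ge0.
move=> N G A A0 pA GA.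
have [small|big] := leqP (G + size A) X.+1.
  apply: (le_trans (HK1 N G A A0 pA small)).
  by rewrite ler_pM2r ?exprn_gt0 // lerDl.
apply: (@le_trans _ _ (Kn * y ^+ sumn A)); last by rewrite ler_pM2r ?exprn_gt0 // lerDr.
have {big GA} GA : (G + size A = X.+2)%N by apply/eqP; rewrite eqn_leq GA big.
elim: N A A0 pA GA => [|N IHN] [|[|a] A] // _ /= pA GA.
  by rewrite tsum0 mulr_ge0 ?exprn_ge0 // ltW.
apply: (le_trans (tsum_step _ _ _ _)).
set sg := (a.+1 + sumn A)%N.
have -> : [&& G == 0, a == 0 & A == [::]]%N = false.
  by apply/negP => /and3P[/eqP G0 _ /eqP A0]; move: GA; rewrite G0 A0.
rewrite add0r.
have S5 : \sum_(p <- picks A) p.1%:R * tsum N G ((a.+1 + p.1)%N :: p.2) <=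
    (sumn A)%:R * (K' * y' ^+ sg).
  apply: (@le_trans _ _ (\sum_(p <- picks A) p.1%:R * (K' * y' ^+ sg))).
    rewrite big_seq [leRHS]big_seq; apply: ler_sum => -[p1 p2] pk.
    have [/= sp zp] := picks_sum_size pk; rewrite ler_wpM2l //.
    have -> : sg = sumn ((a.+1 + p1)%N :: p2) by rewrite /sg /=; nlia.
    apply: HK' => //=; last by nlia.
    have : all (ltn 0) (p1 :: p2) by rewrite (eq_all_r (perm_mem (picks_perm pk))).
    by case/andP.
  rewrite -mulr_suml ler_wpM2r ?mulr_ge0 ?exprn_ge0 ?(ltW y'0) //.
  by rewrite -natr_sum sum_picks_fst.
have S2 : \sum_(k < a) (if (1 < G)%N then tsum N (G - 2) [:: k.+1, (a - k)%N & A] else 0) <=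
    a%:R * (K' * y' ^+ sg).
  rewrite -[X in X%:R * _]card_ord -sum1_card natr_sum mulr_suml; apply: ler_sum => k _.
  have ka := ltn_ord k; rewrite mul1r; case: ifP => G1; last first.
    by rewrite mulr_ge0 ?exprn_ge0 // ltW.
  have -> : sg = sumn [:: k.+1, (a - k)%N & A] by rewrite /sg /=; nlia.
  by apply: HK' => //=; [rewrite subn_gt0 ka | nlia].
have S4 : u * tsum N G (a.+2 :: A) <= u * (Kn * y ^+ sg.+1).
  rewrite ler_pM2l ?u_gt0 //.
  have -> : sg.+1 = sumn (a.+2 :: A) by rewrite /sg /=; nlia.
  exact: IHN.
pose Q := K' * K' * y' ^+ sg.
have Q0 : 0 <= Q by rewrite !mulr_ge0 ?exprn_ge0 // ltW.
have S3 k : (k < a)%N -> \sum_(p <- splits A) \sum_(h < G.+1)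
     tsum N h (k.+1 :: p.1) * tsum N (G - h) ((a - k)%N :: p.2) <=
   c2%:R * Q + psi k * (Kn * y ^+ (sg - k.+1)) +
   psi (a - k.+1) * (Kn * y ^+ (sg - (a - k))).
  move=> ka.
  have psy i j : 0 <= psi i * (Kn * y ^+ j).
    by rewrite mulr_ge0 ?psi_ge0 // mulr_ge0 // exprn_ge0 // ltW.
  have all2 P : \sum_(p <- splits A) (all P p.1 && all (predC P) p.2)%:R = 1 :> R.
    by rewrite -natr_sum sum_splits_pred.
  (* [f1] and [f2] indicate the splittings where the left or the right factor is a disk; written
     with [all], their sums are [1] by [sum_splits_pred]. *)
  pose f1 (p : seq nat * seq nat) (h : nat) : R :=
     (h == 0%N)%:R * (all pred0 p.1 && all (predC pred0) p.2)%:R.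
  pose f2 (p : seq nat * seq nat) (h : nat) : R :=
     (h == G)%:R * (all predT p.1 && all (predC predT) p.2)%:R.
  apply: (@le_trans _ _ (\sum_(p <- splits A) \sum_(h < G.+1)
     (Q + psi k * (Kn * y ^+ (sg - k.+1)) * f1 p h +
      psi (a - k.+1) * (Kn * y ^+ (sg - (a - k))) * f2 p h))).
    rewrite big_seq [leRHS]big_seq; apply: ler_sum => -[p1 p2] pk.
    have [/= sp zp] := splits_sum_size pk; apply: ler_sum => h _; have hG := ltn_ord h.
    have : all (ltn 0) (p1 ++ p2) by rewrite (eq_all_r (perm_mem (splits_perm pk))).
    rewrite all_cat => /andP[pp1 pp2].
    have [e1|n1] := boolP ((nat_of_ord h == 0%N) && (@size nat p1 == 0%N)).
      move: e1 => /andP[/eqP h0 /eqP/size0nil p10].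
      have f1E : f1 (p1, p2) h = 1.
        by rewrite /f1 h0 p10 /= mul1r (eq_all (a2 := predT)) ?all_predT.
      rewrite f1E mulr1; apply: (@le_trans _ _ (psi k * (Kn * y ^+ (sg - k.+1)))); last first.
        rewrite -addrA addrCA lerDl addr_ge0 // mulr_ge0 //; exact: mulr_ge0.
      rewrite h0 p10 subn0; apply: ler_pM; rewrite ?tsum_ge0 ?tsum_disk //.
      have -> : (sg - k.+1 = sumn ((a - k)%N :: p2))%N.
        by rewrite /sg /=; move: sp; rewrite p10 /=; nlia.
      apply: IHN => //=; first by rewrite subn_gt0 ka.
      by move: zp; rewrite p10 /=; nlia.
    have [e2|n2] := boolP ((nat_of_ord h == G) && (@size nat p2 == 0%N)).
      move: e2 => /andP[/eqP hGe /eqP/size0nil p20].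
      have f2E : f2 (p1, p2) h = 1.
        by rewrite /f2 hGe p20 /= eqxx mul1r all_predT.
      rewrite f2E mulr1; apply: (@le_trans _ _ (psi (a - k.+1) * (Kn * y ^+ (sg - (a - k))))); last first.
        rewrite lerDr addr_ge0 // mulr_ge0 //; exact: mulr_ge0.
      rewrite hGe p20 subnn mulrC.
      have -> : ((a - k) = (a - k.+1).+1)%N by rewrite subnSK.
      apply: ler_pM; rewrite ?tsum_ge0 ?tsum_disk //.
      have -> : (sg - (a - k.+1).+1 = sumn (k.+1 :: p1))%N.
        by rewrite /sg /=; move: sp; rewrite p20 /=; nlia.
      apply: IHN => //=.
      by move: zp; rewrite p20 /=; nlia.
    (* In the remaining splittings both factors have complexity at most [X + 1], so [HK'] bounds
       each. *)
    apply: (@le_trans _ _ Q); last first.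
      by rewrite -addrA lerDl addr_ge0 // mulr_ge0 //; apply: mulr_ge0.
    have -> : Q = (K' * y' ^+ sumn (k.+1 :: p1)) * (K' * y' ^+ sumn ((a - k)%N :: p2)).
      by rewrite /Q [RHS]mulrACA -exprD; congr (_ * _ ^+ _); rewrite /sg /=; nlia.
    apply: ler_pM; rewrite ?tsum_ge0 //; apply: HK' => //=; rewrite ?subn_gt0 ?ka //.
      by move: n2; nlia.
    by move: n1; nlia.
  under eq_bigr => p _ do rewrite !big_split /= -!mulr_sumr -!mulr_suml.
  have -> : \sum_(h < G.+1) (nat_of_ord h == 0%N)%:R = 1 :> R.
    by rewrite big_ord_recl big1 ?addr0.
  have -> : \sum_(h < G.+1) (nat_of_ord h == G)%:R = 1 :> R.
    rewrite big_ord_recr big1 /= ?eqxx ?add0r // => h _.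
    by have := ltn_ord h; case: eqP => // ->; rewrite ltnn.
  rewrite !big_split /= -!mulr_sumr.
  rewrite !all2 !mulr1 !lerD2r sumr_const card_ord big_const_seq count_predT.
  rewrite iter_addr_0 size_splits -mulrnA mulrnAr -/Q -mulr_natl ler_wpM2r // ler_nat mulnC.
  by apply: c2E; nlia.
have R1 : \sum_(k < a) psi k * (Kn * y ^+ (sg - k.+1)) <= Kn * y ^+ sg * Psiv v.
  apply: le_trans (ler_wpM2l _ (psi_sum_le a gv)); last first.
    by rewrite mulr_ge0 // exprn_ge0 // ltW.
  rewrite mulr_sumr; apply: ler_sum => k _; have ka := ltn_ord k.
  rewrite mulrCA -[leRHS]mulrA ler_wpM2l // [leRHS]mulrCA ler_wpM2l ?psi_ge0 //.
  have {2}-> : sg = (sg - k.+1 + k.+1)%N by rewrite /sg; nlia.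
  by rewrite exprD -mulrA -exprMn divff ?expr1n ?mulr1 // gt_eqF.
have R2 : \sum_(k < a) psi (a - k.+1) * (Kn * y ^+ (sg - (a - k))) <= Kn * y ^+ sg * Psiv v.
  apply: le_trans R1; rewrite [leRHS](reindex_inj rev_ord_inj) /=; apply: ler_sum => k _.
  by rewrite subnSK.
rewrite big_split /=.
have S3' : \sum_(k < a) \sum_(p <- splits A) \sum_(h < G.+1)
     tsum N h (k.+1 :: p.1) * tsum N (G - h) ((a - k)%N :: p.2) <=
   a%:R * (c2%:R * Q) + 2 * (Kn * y ^+ sg * Psiv v).
  apply: (@le_trans _ _ (\sum_(k < a) (c2%:R * Q + psi k * (Kn * y ^+ (sg - k.+1)) +
   psi (a - k.+1) * (Kn * y ^+ (sg - (a - k)))))).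
    by apply: ler_sum => k _; apply: S3.
  rewrite !big_split /= sumr_const card_ord -mulr_natl.
  move: R1 R2; lra.
have Msg : a%:R * (K' * y' ^+ sg) + (sumn A)%:R * (K' * y' ^+ sg) +
    a%:R * (c2%:R * Q) <= M * (sg%:R * y' ^+ sg).
  have asg : a%:R <= sg%:R :> R by rewrite ler_nat /sg; nlia.
  have aAsg : a%:R + (sumn A)%:R <= sg%:R :> R by rewrite -natrD ler_nat /sg; nlia.
  have Y0 : 0 <= y' ^+ sg by rewrite exprn_ge0 // ltW.
  have h1 : (a%:R + (sumn A)%:R) * (K' * y' ^+ sg) <= sg%:R * (K' * y' ^+ sg).
    by rewrite ler_wpM2r // mulr_ge0.
  have h2 : a%:R * (c2%:R * Q) <= sg%:R * (c2%:R * Q).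
    by rewrite ler_wpM2r // mulr_ge0.
  have -> : M * (sg%:R * y' ^+ sg) = sg%:R * (K' * y' ^+ sg) +
     sg%:R * (c2%:R * Q) by rewrite /M /Q; ring.
  move: h1 h2; lra.
have Dsg : M * (sg%:R * y' ^+ sg) <= Kn * slack v * y ^+ sg.
  rewrite /Kn divfK ?gt_eqF // -mulrA ler_wpM2l //; exact: natr_exp_le.
(* By the definition of [slack]: the two disk terms and the [u] term use up all of the bound but the
   part reserved for smaller complexity. *)
have E : Kn * y ^+ sg = 2 * (Kn * y ^+ sg * Psiv v) + u * (Kn * y ^+ sg.+1) +
    Kn * slack v * y ^+ sg by rewrite /slack -/y exprS; ring.
rewrite -[sg]/(a.+1 + sumn A)%N -/sg E.
move: S5 S2 S4 S3' Msg Dsg; lra.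
Qed.

End Bounds.

(** * Bounds on full coefficient sums, and uniqueness of the planar solution *)

Section Consequences.
Variables (R : archiRealFieldType) (s : R).
Hypotheses (s1 : 1 / 3 < s) (s2 : s < 1 / 2).
Let u : R := 2 * s ^+ 2 * (1 - 2 * s).

Local Ltac slra := move: (s1) (s2) => ? ?; lra.

Lemma good_exists : exists v, good s v.
Proof.
have k0 := kap_gt0 s1 s2; have k1 := kap_lt s1 s2.
set k := (1 - 2 * s) / (4 * s) in k0 k1.
(* For this [v], [v (1 - v) - k = (1/4 - k) (3/4 + k)]. *)
exists (1 / 4 + k); rewrite /good -/k; apply/and3P; split; [lra | lra |].
nra.
Qed.

Lemma psum_le_tsum G a A M : exists N,
  \sum_(n < M) ct R G (a :: A) n * u ^+ n <= tsum s N G (a :: A).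
Proof.
set N := (sumn (a :: A) + size (a :: A) + 2 * M + G)%N; exists N.
have MN : (M <= N.+1)%N by rewrite /N; lia.
rewrite (tsum_widen s1 s2 _ _ (leqnn N.+1)).
have -> : \sum_(n < N.+1) (if (sumn (a :: A) + size (a :: A) + 2 * n + G <= N.+1)%N
     then ct R G (a :: A) n * u ^+ n else 0) =
   \sum_(n < M) (ct R G (a :: A) n * u ^+ n) +
   \sum_(M <= n < N.+1) (if (sumn (a :: A) + size (a :: A) + 2 * n + G <= N.+1)%N
     then ct R G (a :: A) n * u ^+ n else 0).
  rewrite -(big_mkord predT (fun n => if (sumn (a :: A) + size (a :: A) + 2 * n + G <= N.+1)%N
     then ct R G (a :: A) n * u ^+ n else 0)).
  rewrite (@big_cat_nat _ _ _ M) //= big_mkord; congr (_ + _).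
  apply: eq_bigr => n _; rewrite ifT //; have := ltn_ord n; rewrite /N /=; lia.
rewrite lerDl; apply: sumr_ge0 => n _; case: ifP => // _.
exact: ctu_ge0.
Qed.

Lemma psum_disk_le a M : \sum_(n < M) ct R 0 [:: a.+1] n * u ^+ n <= psi s a.
Proof.
by have [N le] := psum_le_tsum 0 a.+1 [::] M; apply: (le_trans le); apply: tsum_disk.
Qed.

Lemma ct1_bounded G : exists K : R, forall n, ct R G [:: 1%N] n * u ^+ n <= K.
Proof.
have [v gv] := good_exists; have [K K0 HK] := tsum_bound s1 s2 G gv.
exists (K * yv s v ^+ 1) => n.
have [N le] := psum_le_tsum G 1 [::] n.+1.
apply: (@le_trans _ _ (\sum_(i < n.+1) ct R G [:: 1%N] i * u ^+ i)).
  by rewrite big_ord_recr /= lerDr; apply: sumr_ge0 => i _; apply: ctu_ge0.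
by apply: (le_trans le); apply: (HK N G [:: 1%N]); rewrite //= addn1.
Qed.

Lemma psi0E : psi s 0 = (6 * s - 1) / (8 * s ^+ 2).
Proof.
have s0 : s != 0 by rewrite gt_eqF //; slra.
by rewrite /psi /catalan /=; field.
Qed.

(* Summed against the powers of [x = (yv v)^-1], the loop equation for [psi - phi] reads
   [slack v * D <= - u * (psi 0 - phi 0)] with [D >= 0]. *)
Lemma psi_unique (phi : nat -> R) :
  (forall a, 0 <= phi a) -> (forall a, phi a <= psi s a) ->
  (forall a, (a == 0)%N%:R + \sum_(k < a) phi k * phi (a - k.+1)%N + u * phi a.+1 <= phi a) ->
  phi 0%N = psi s 0.
Proof.
move=> p0 ple prec; have u0 : 0 < u := u_gt0 s1 s2.
have [v gv] := good_exists; have [v' gv' yy] := good_between s1 s2 gv.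
have sl := slack_gt0 s1 s2 gv; have y0 := yv_gt0 s1 s2 gv; have y'0 := yv_gt0 s1 s2 gv'.
pose de a := psi s a - phi a.
have d0 a : 0 <= de a by rewrite subr_ge0.
have dle a : de a <= psi s a by rewrite gerBl.
pose x := (yv s v)^-1; have x0 : 0 < x by rewrite invr_gt0.
(* Since [0 <= phi <= psi], the difference of the quadratic terms is at most its linearisation at
   [psi]. *)
have drec a : de a <= 2 * \sum_(k < a) psi s k * de (a - k.+1)%N + u * de a.+1.
  have E : psi s a = _ := psi_rec s1 s2 a.
  have := prec a; rewrite {1}/de E -/u => h.
  have h2 : \sum_(k < a) psi s k * psi s (a - k.+1) - \sum_(k < a) phi k * phi (a - k.+1)%N <=
      2 * \sum_(k < a) psi s k * de (a - k.+1)%N.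
    have -> : 2 * \sum_(k < a) psi s k * de (a - k.+1)%N =
       \sum_(k < a) (psi s k * de (a - k.+1)%N + de k * psi s (a - k.+1)).
      rewrite mulr_natl mulr2n big_split /=; congr (_ + _).
      rewrite (reindex_inj rev_ord_inj) /=; apply: eq_bigr => k _.
      by rewrite subnSK // subKn 1?mulrC // ltnW.
    rewrite -sumrB; apply: ler_sum => k _; rewrite /de.
    have := p0 k; have := ple k; have := p0 (a - k.+1)%N; have := ple (a - k.+1)%N.
    move: (psi s k) (phi k) (psi s _) (phi _) => A1 A2 A3 A4 *; nra.
  move: h h2; rewrite /de mulrBr; lra.
have PS := psi_sum_le s1 s2 _ gv.
have hx n : 0 <= x ^+ n by rewrite exprn_ge0 // ltW.
have px n : 0 <= psi s n * x ^+ n.+1 by rewrite mulr_ge0 // psi_ge0.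
have dx n : 0 <= de n * x ^+ n.+1 by rewrite mulr_ge0.
have conv_le M : \sum_(a < M) (\sum_(k < a) psi s k * de (a - k.+1)%N) * x ^+ a.+1 <=
    Psiv s v * \sum_(a < M) de a * x ^+ a.+1.
  case: M => [|M]; first by rewrite !big_ord0 mulr0.
  rewrite big_ord_recl big_ord0 mul0r add0r.
  pose g k l := (psi s k * x ^+ k.+1) * (de l * x ^+ l.+1).
  have g0 k l : 0 <= g k l by rewrite /g mulr_ge0.
  apply: (@le_trans _ _ (\sum_(a < M) \sum_(k < a.+1) g k (a - k)%N)).
    apply: ler_sum => a _; rewrite /= /bump add1n mulr_suml; apply: ler_sum => k _.
    have ka : (k <= a)%N by rewrite -ltnS.
    rewrite /g subSS [leRHS]mulrACA -exprD.
    by have -> : (k.+1 + (a - k).+1 = a.+2)%N by lia.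
  apply: (le_trans (ler_sum_triangle M g0)).
  have -> : \sum_(l < M) \sum_(m < M) g l m =
     (\sum_(l < M) psi s l * x ^+ l.+1) * \sum_(m < M) de m * x ^+ m.+1.
    by rewrite mulr_suml; apply: eq_bigr => l _; rewrite mulr_sumr.
  apply: ler_pM; rewrite ?PS ?sumr_ge0 //.
  by rewrite big_ord_recr /= lerDl.
(* Cutting the sum at [M] leaves a boundary term, which takes the place of [0] on the right. *)
have key M : u * de 0%N <= u * yv s v * (de M * x ^+ M.+1).
  pose D := \sum_(a < M) de a * x ^+ a.+1.
  have D0 : 0 <= D by apply: sumr_ge0.
  have T1 := conv_le M; rewrite -/D in T1.
  have T2 : \sum_(a < M) u * de a.+1 * x ^+ a.+1 =
      u * yv s v * (D + de M * x ^+ M.+1) - u * de 0%N.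
    have xy : yv s v * x = 1 by rewrite /x divff // gt_eqF.
    have -> : D + de M * x ^+ M.+1 = de 0%N * x + \sum_(a < M) de a.+1 * x ^+ a.+2.
      transitivity (\sum_(a < M.+1) de a * x ^+ a.+1); first by rewrite big_ord_recr.
      by rewrite big_ord_recl /= expr1.
    have -> : \sum_(a < M) u * de a.+1 * x ^+ a.+1 =
        u * (yv s v * x) * \sum_(a < M) de a.+1 * x ^+ a.+1.
      by rewrite xy mulr1 mulr_sumr; apply: eq_bigr => a _; rewrite mulrA.
    have -> : \sum_(a < M) de a.+1 * x ^+ a.+2 = x * \sum_(a < M) de a.+1 * x ^+ a.+1.
      by rewrite mulr_sumr; apply: eq_bigr => a _; rewrite exprS mulrCA.
    have -> : u * yv s v * (de 0%N * x + x * \sum_(a < M) de a.+1 * x ^+ a.+1) - u * de 0%N =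
        u * (yv s v * x) * \sum_(a < M) de a.+1 * x ^+ a.+1 +
        u * de 0%N * (yv s v * x) - u * de 0%N by ring.
    by rewrite xy mulr1; ring.
  have T3 : D <= 2 * \sum_(a < M) (\sum_(k < a) psi s k * de (a - k.+1)%N) * x ^+ a.+1 +
      \sum_(a < M) u * de a.+1 * x ^+ a.+1.
    rewrite mulr_sumr -big_split /=; apply: ler_sum => a _.
    by rewrite mulrA -mulrDl ler_pM2r ?exprn_gt0.
  have T4 : 0 <= D * slack s v by rewrite mulr_ge0 // ltW.
  move: T1 T3 T4; rewrite T2 /slack -/u; lra.
(* [de n] is at most [Psiv s v' * yv s v' ^+ n.+1] and [yv s v' < yv s v], so the boundary term is
   [O(1/n)]. *)
pose C := (yv s v / yv s v' - 1)^-1.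
have bnd n : n%:R * de 0%N <= yv s v * (Psiv s v' * C).
  case: n => [|n].
    rewrite mul0r mulr_ge0 ?(ltW y0) // mulr_ge0 //.
      by apply: le_trans (psi_sum_le s1 s2 0 gv'); rewrite big_ord0.
    by rewrite invr_ge0 subr_ge0 ler_pdivlMr // mul1r ltW.
  have h1 : de 0%N <= yv s v * (de n * x ^+ n.+1).
    by rewrite -(ler_pM2l u0) mulrA key.
  have h2 : n.+1%:R * de n <= Psiv s v' * (C * yv s v ^+ n.+1).
    apply: (@le_trans _ _ (Psiv s v' * (n.+1%:R * yv s v' ^+ n.+1))).
      rewrite mulrCA ler_pM2l ?ltr0n //; apply: (le_trans (dle n)); exact: psi_le.
    apply: ler_wpM2l; last exact: natr_exp_le.
    by apply: le_trans (psi_sum_le s1 s2 0 gv'); rewrite big_ord0.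
  apply: (@le_trans _ _ (n.+1%:R * (yv s v * (de n * x ^+ n.+1)))).
    by rewrite ler_pM2l ?ltr0n.
  have -> : n.+1%:R * (yv s v * (de n * x ^+ n.+1)) =
     yv s v * (n.+1%:R * de n * x ^+ n.+1) by ring.
  rewrite ler_pM2l //.
  have -> : Psiv s v' * C = Psiv s v' * (C * yv s v ^+ n.+1) * x ^+ n.+1.
    by rewrite -!mulrA -exprMn divff ?expr1n ?mulr1 // gt_eqF.
  by rewrite ler_pM2r ?exprn_gt0.
apply/eqP; rewrite eq_le ple /= -subr_le0 -/(de 0%N) leNgt; apply/negP => dp.
set B := yv s v * _ in bnd.
have B0 : 0 <= B / de 0%N by apply: divr_ge0 (ltW dp); have := bnd 0%N; rewrite mul0r.
have := archi_boundP B0; set n := Num.bound _; rewrite ltr_pdivrMr // ltNge => /negP; apply.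
exact: bnd.
Qed.

End Consequences.

End TopologicalBounds.

(** * The planar series as a power series over the reals *)

Module PlanarSeries.
Import Reals Coquelicot.
Import all_boot all_order all_algebra Rstruct LoopEquation TopologicalBounds.
Set Implicit Arguments.
Unset Strict Implicit.
Unset Printing Implicit Defensive.
Import Order.TTheory GRing.Theory Num.Theory.
Local Open Scope ring_scope.

Definition cubic (s : R) : R := 2 * s ^+ 2 * (1 - 2 * s).
Definition fser a n : R := ct R 0 [:: a.+1] n.

Lemma fser_ge0 a n : 0 <= fser a n.
Proof. exact: ct_ge0. Qed.

Lemma fser_psum (s : R) a M : 1 / 3 < s -> s < 1 / 2 ->
  sum_n (fun n => fser a n * cubic s ^+ n) M <= psi s a.
Proof.
move=> s1 s2; rewrite sum_n_Reals sum_f_R0E big_mkord; exact: psum_disk_le.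
Qed.

Lemma fser_rec a n :
  fser a n = ((a == 0)%N && (n == 0)%N)%:R +
    \sum_(k < a) PS_mult (fser k) (fser (a - k.+1)) n + PS_incr_1 (fser a.+1) n.
Proof.
rewrite /fser ct_rec big_nil addr0 /=; congr (_ + _ + _).
apply: eq_bigr => k _; rewrite add0r big_seq1 /= /PS_mult sum_f_R0E big_mkord.
apply: eq_bigr => l _; rewrite big_ord1 subnn subnSK //.
Qed.

Lemma fser_unique (s : R) (phi : nat -> R) : 1 / 3 < s -> s < 1 / 2 ->
  (forall a, 0 <= phi a) -> (forall a, phi a <= psi s a) ->
  (forall a : nat, (a == 0%N)%:R + \sum_(k < a) phi k * phi (subn a k.+1) + cubic s * phi a.+1 <= phi a) ->
  phi 0%N = (6 * s - 1) / (8 * s ^+ 2).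
Proof.
by move=> s1 s2 h1 h2 h3; rewrite (psi_unique s1 s2 h1 h2 h3) psi0E.
Qed.

Lemma fser_term (s : R) a n : 1 / 3 < s -> s < 1 / 2 ->
  fser a n * cubic s ^+ n <= psi s a.
Proof.
move=> s1 s2; apply: le_trans (psum_disk_le s1 s2 a n.+1).
rewrite big_ord_recr /= lerDr; apply: sumr_ge0 => i _; exact: ctu_ge0.
Qed.

Lemma natrIZR n : n%:R = IZR (BinInt.Z.of_nat n) :> R.
Proof. by rewrite -INRE INR_IZR_INZ. Qed.

Lemma third_lt (s : R) : Rlt (Rdiv (IZR 1) (IZR 3)) s -> 1 / 3 < s.
Proof. by move/RltP; rewrite RdivE -(natrIZR 3). Qed.

Lemma lt_half (s : R) : Rlt s (Rdiv (IZR 1) (IZR 2)) -> s < 1 / 2.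
Proof. by move/RltP; rewrite RdivE -(natrIZR 2). Qed.

Lemma cubicE (s : R) :
  cubic s = Rmult (Rmult (IZR 2) (pow s 2)) (Rminus (IZR 1) (Rmult (IZR 2) s)).
Proof. by rewrite /cubic RpowE !RmultE RminusE -(natrIZR 2). Qed.

Lemma is_pseries0 (x : R) : is_pseries (fun _ => 0 : R) x (0 : R).
Proof.
rewrite -[X in is_pseries _ _ X](PSeries_const_0 x); apply: PSeries_correct.
by apply: CV_radius_inside; rewrite CV_radius_const_0.
Qed.

Lemma is_pseries_delta (x : R) : is_pseries (fun n => (n == 0%N)%:R : R) x (1 : R).
Proof.
change (is_lim_seq (sum_n (fun k => scal (pow_n x k) ((k == 0%N)%:R : R))) (Rbar.Finite 1)).
apply: (is_lim_seq_ext (fun=> 1 : R)); last exact: is_lim_seq_const.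
move=> n; rewrite /=; elim: n => [|n IH].
  rewrite sum_O /= /scal /= /mult /= /one /= ; change (1 = 1 * 1 :> R); by rewrite mulr1.
rewrite sum_Sn -IH /= /scal /= /mult /= /plus /=.
by change (1 = 1 + (x * pow_n x n) * 0 :> R); rewrite mulr0 addr0.
Qed.

Lemma is_pseries_bigsum (g : nat -> nat -> R) (l : nat -> R) (x : R) m :
  (forall k, (k < m)%N -> is_pseries (g k) x (l k)) ->
  is_pseries (fun n => \sum_(k < m) g k n) x (\sum_(k < m) l k).
Proof.
elim: m => [|m IH] H.
  rewrite big_ord0; apply: (is_pseries_ext (fun=> 0 : R)); last exact: is_pseries0.
  by move=> n; rewrite big_ord0.
rewrite big_ord_recr /=.
apply: (is_pseries_ext (PS_plus (fun n => \sum_(k < m) g k n) (g m))).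
  by move=> n; rewrite big_ord_recr.
apply: is_pseries_plus; last exact: H.
by apply: IH => k km; apply: H; apply: ltnW.
Qed.

Lemma fser_PSeries_rec (x : R) (a : nat) :
  (forall b, Rbar_lt (Rabs x) (CV_radius (fser b))) ->
  PSeries (fser a) x = (a == 0%N)%:R +
    \sum_(k < a) PSeries (fser k) x * PSeries (fser (subn a k.+1)) x +
    x * PSeries (fser a.+1) x.
Proof.
move=> H; have C b : is_pseries (fser b) x (PSeries (fser b) x).
  by apply: PSeries_correct; apply: CV_radius_inside.
apply: is_pseries_unique.
pose e (n : nat) : R := ((a == 0)%N && (n == 0)%N)%:R.
apply: (is_pseries_ext (PS_plus (PS_plus e
   (fun n => \sum_(k < a) PS_mult (fser k) (fser (subn a k.+1)) n)) (PS_incr_1 (fser a.+1)))).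
  by move=> n; rewrite [RHS]fser_rec.
apply: is_pseries_plus; last exact: is_pseries_incr_1.
apply: is_pseries_plus.
  rewrite /e; case: (a == 0%N); last exact: is_pseries0.
  exact: is_pseries_delta.
apply: (@is_pseries_bigsum (fun k => PS_mult (fser k) (fser (subn a k.+1)))
  (fun k => PSeries (fser k) x * PSeries (fser (subn a k.+1)) x)) => k _.
exact: is_pseries_mult.
Qed.

Lemma fser_is_lim (x : R) a : Rbar_lt (Rabs x) (CV_radius (fser a)) ->
  is_lim_seq (sum_n (fun n => fser a n * x ^+ n)) (PSeries (fser a) x).
Proof.
move=> H; have := PSeries_correct _ _ (CV_radius_inside _ _ H).
change (is_pseries (fser a) x (PSeries (fser a) x) ->
  is_series (fun n => fser a n * x ^+ n) (PSeries (fser a) x)).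
apply: is_series_ext => n; rewrite -RpowE pow_n_pow mulrC.
by [].
Qed.

(** The sums of the planar series satisfy the planar equation exactly, and inherit nonnegativity and
    the bound by [psi] from their partial sums; so the uniqueness lemma applies. *)
Lemma fser_PSeries_value (s : R) :
  Rlt (Rdiv (IZR 1) (IZR 3)) s -> Rlt s (Rdiv (IZR 1) (IZR 2)) ->
  (forall b, Rbar_lt (Rabs (cubic s)) (CV_radius (fser b))) ->
  PSeries (fser 0) (cubic s) =
  Rdiv (Rminus (Rmult (IZR 6) s) (IZR 1)) (Rmult (IZR 8) (pow s 2)).
Proof.
move=> /third_lt s1 /lt_half s2 H.
have -> : Rdiv (Rminus (Rmult (IZR 6) s) (IZR 1)) (Rmult (IZR 8) (pow s 2)) =
   (6 * s - 1) / (8 * s ^+ 2).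
  by rewrite RdivE RpowE !RmultE RminusE -(natrIZR 6) -(natrIZR 8).
have u0 : 0 <= cubic s by apply/ltW/u_gt0.
apply: (fser_unique (phi := fun a => PSeries (fser a) (cubic s)) s1 s2) => a.
- apply/RleP; apply: (is_lim_seq_le (fun=> 0 : R) _ (0 : R) _ _ (is_lim_seq_const _) (fser_is_lim (H a))).
  move=> n; apply/RleP; rewrite sum_n_Reals sum_f_R0E.
  by apply: sumr_ge0 => i _; rewrite mulr_ge0 ?fser_ge0 ?exprn_ge0.
- apply/RleP; apply: (is_lim_seq_le _ (fun=> psi s a) _ (psi s a) _ (fser_is_lim (H a)) (is_lim_seq_const _)).
  by move=> n; apply/RleP; apply: fser_psum.
by rewrite -fser_PSeries_rec.
Qed.

Lemma fser_radius (s : R) a :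
  Rlt (Rdiv (IZR 1) (IZR 3)) s -> Rlt s (Rdiv (IZR 1) (IZR 2)) ->
  Rbar_le (cubic s) (CV_radius (fser a)).
Proof.
move=> /third_lt s1 /lt_half s2; have [ub _] := CV_radius_bounded (fser a).
apply: ub; exists (psi s a) => n; have u0 : 0 <= cubic s by apply/ltW/u_gt0.
apply/RleP; rewrite RabsE RpowE ger0_norm; first exact: fser_term.
by rewrite mulr_ge0 ?fser_ge0 ?exprn_ge0.
Qed.

(** One of the [n + 1] fixed points is the marked cycle of [ct], hence the denominator [n!]. *)
Lemma ct1_boundedR (s : R) G :
  Rlt (Rdiv (IZR 1) (IZR 3)) s -> Rlt s (Rdiv (IZR 1) (IZR 2)) ->
  exists K : R, forall n,
   Rle (Rmult (Rdiv (INR (CN (2 * n + G) (nseq n.+1 1%N))) (INR n`!)) (pow (cubic s) n)) K.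
Proof.
move=> /third_lt s1 /lt_half s2; have [K HK] := ct1_bounded s1 s2 G.
exists K => n; apply/RleP; have := HK n.
have E : (sumn [:: 1] + size [:: 1] + 2 * n + G - 2 = 2 * n + G)%N.
  by rewrite -[X in (X - _)%N]addnA; apply: (addKn 2).
by rewrite /ct E /= !INRE RpowE RdivE.
Qed.

Lemma fser0E n : fser 0 n = Rdiv (INR (CN (2 * n) (nseq n.+1 1%N))) (INR n`!).
Proof. 
have E : (sumn [:: 1] + size [:: 1] + 2 * n + 0 - 2 = 2 * n)%N.
  by rewrite addn0; apply: (addKn 2).
by rewrite /fser /ct E /= !INRE RdivE.
 Qed.

End PlanarSeries.

(** * The two bounds on the radius of convergence *)

Module Radius.
Import all_boot Defs LoopEquation WalkCounting PlanarSeries.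
Import Reals Lra Lia Coquelicot.
Open Scope R_scope.

(** [cubic] decreases from [1/3] to [1/2], so the midpoint [s'] of [1/3] and [s] gives a strictly
    larger lower bound on the radius. *)
Lemma fser_inside (s : R) (a : nat) : 1 / 3 < s -> s < 1 / 2 ->
  Rbar_lt (Rabs (cubic s)) (CV_radius (fser a)).
Proof.
intros s1 s2; set (s' := (s + 1 / 3) / 2).
assert (t1 : 1 / 3 < s') by (unfold s'; lra).
assert (t2 : s' < 1 / 2) by (unfold s'; lra).
apply Rbar_lt_le_trans with (cubic s'); [|apply fser_radius; assumption].
rewrite !cubicE; simpl.
assert (pos : 0 < 2 * (s * (s * 1)) * (1 - 2 * s)).
{ apply Rmult_lt_0_compat; [nra | lra]. }
rewrite Rabs_pos_eq; [|lra].
assert (E : s = s' + (s' - 1 / 3)) by (unfold s'; lra).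
rewrite E; set (e := s' - 1 / 3).
assert (e0 : 0 < e) by (unfold e; lra).
replace s' with (1 / 3 + e) by (unfold e; lra).
nra.
Qed.

(** To the right of [1/3] the derivative [Q] of the series satisfies [Q (cubic s) = 1 / (16 s^4)].
    If [Q] were differentiable at [2/27], the left side would have derivative [0] at the critical
    point [1/3] of [cubic]; the right side does not. *)
Lemma not_fser_radius_gt : ~ Rbar_lt (2 / 27) (CV_radius (fser 0)).
Proof.
intro H; set (Q := PSeries (PS_derive (fser 0))).
assert (PQ : forall s, 1 / 3 < s -> s < 1 / 2 -> Q (cubic s) = / (16 * s ^ 4)).
{ intros s s1 s2.
  assert (D1 : is_derive (fun t => PSeries (fser 0) (cubic t)) s
            ((4 * s - 12 * s ^ 2) * Q (cubic s))).
  { apply (is_derive_comp (PSeries (fser 0)) cubic).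
    - apply is_derive_PSeries; apply fser_inside; assumption.
    - apply (is_derive_ext (fun t => 2 * t ^ 2 * (1 - 2 * t))).
      + intro t; rewrite cubicE; reflexivity.
      + auto_derive; [exact I | ring]. }
  assert (D2 : is_derive (fun t => PSeries (fser 0) (cubic t)) s
            ((1 - 3 * s) / (4 * s ^ 3))).
  { apply (is_derive_ext_loc (fun t => (6 * t - 1) / (8 * t ^ 2))).
    - assert (e0 : 0 < Rmin (s - 1 / 3) (1 / 2 - s)) by (apply Rmin_glb_lt; lra).
      exists (mkposreal _ e0); intros t Ht.
      unfold ball in Ht; simpl in Ht; unfold AbsRing_ball, abs, minus, plus, opp in Ht.
      simpl in Ht.
      assert (h1 := Rmin_l (s - 1 / 3) (1 / 2 - s)).
      assert (h2 := Rmin_r (s - 1 / 3) (1 / 2 - s)).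
      apply Rabs_def2 in Ht.
      symmetry; apply fser_PSeries_value; [lra | lra |].
      intro b; apply fser_inside; lra.
    - auto_derive; [nra | field; lra]. }
  assert (E := is_derive_unique _ _ _ D1); rewrite (is_derive_unique _ _ _ D2) in E.
  assert (n0 : 4 * s - 12 * s ^ 2 <> 0) by nra.
  apply (Rmult_eq_reg_l (4 * s - 12 * s ^ 2)); [|exact n0].
  rewrite <- E; field; lra. }
assert (c13 : cubic (1 / 3) = 2 / 27) by (rewrite cubicE; field).
(* The first term contributes [0], because [cubic] is critical at [1/3]; [l] is [1 / (4 t^5)] at
   [t = 1/3], coming from the second. *)
set (l := 243 / 4).
assert (D : is_derive (fun t => Q (cubic t) - / (16 * t ^ 4)) (1 / 3) l).
{ replace l with (minus ((4 * (1/3) - 12 * (1/3) ^ 2) *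
      PSeries (PS_derive (PS_derive (fser 0))) (cubic (1/3))) (- (243 / 4))).
  - apply (is_derive_minus (fun t => Q (cubic t)) (fun t => / (16 * t ^ 4))).
    + apply (is_derive_comp Q cubic).
      * apply is_derive_PSeries; rewrite CV_radius_derive c13 Rabs_pos_eq; [exact H | lra].
      * apply (is_derive_ext (fun t => 2 * t ^ 2 * (1 - 2 * t))).
        { intro t; rewrite cubicE; reflexivity. }
        auto_derive; [exact I | ring].
    + auto_derive; [lra | field].
  - unfold minus, plus, opp, l; simpl; field. }
apply is_derive_Reals in D; destruct (D 1 Rlt_0_1) as [d Hd].
assert (d0 := cond_pos d).
set (h := Rmin (d / 2) (1 / 12)).
assert (h0 : 0 < h) by (apply Rmin_glb_lt; lra).
assert (hd : h <= d / 2) by apply Rmin_l.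
assert (h12 : h <= 1 / 12) by apply Rmin_r.
assert (A1 := Hd h); assert (A2 := Hd (h / 2)).
rewrite PQ in A1; [|lra|lra]; rewrite PQ in A2; [|lra|lra].
rewrite Rminus_diag in A1; rewrite Rminus_diag in A2.
set (e := Q (cubic (1 / 3)) - / (16 * (1 / 3) ^ 4)) in A1, A2.
assert (B1 := A1 ltac:(lra) ltac:(rewrite Rabs_pos_eq; lra)).
assert (B2 := A2 ltac:(lra) ltac:(rewrite Rabs_pos_eq; lra)).
(* The quotient at [h / 2] is twice the one at [h], so they cannot both be within [1] of [243/4],
   whatever the value [e] at [1/3]. *)
replace ((0 - e) / (h / 2)) with (2 * ((0 - e) / h)) in B2 by (field; lra).
apply Rabs_def2 in B1; apply Rabs_def2 in B2; unfold l in *; lra.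
Qed.

Lemma INR_exp4 n : INR (expn 4 n) = 4 ^ n.
Proof.
induction n as [|n IH]; [reflexivity|].
rewrite expnS mult_INR IH; simpl; ring.
Qed.

Lemma Fseries_radius_ge (g : nat) (s : R) : 1 / 3 < s -> s < 1 / 2 ->
  Rbar_le (cubic s / 4) (CV_radius (Fseries g)).
Proof.
intros s1 s2; destruct (CV_radius_bounded (Fseries g)) as [ub _].
destruct (ct1_boundedR (2 * g) s1 s2) as [K HK].
assert (c0 : 0 <= cubic s).
{ rewrite cubicE; apply Rmult_le_pos; [nra | lra]. }
assert (K0 : 0 <= K).
{ eapply Rle_trans; [|apply (HK 0%nat)]; apply Rmult_le_pos; [|simpl; lra].
  apply Rmult_le_pos; [apply pos_INR|]; apply Rlt_le, Rinv_0_lt_compat, lt_0_INR.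
  apply/ltP; exact: fact_gt0. }
apply ub; exists (cubic s * K); intros [|n].
{ unfold Fseries; simpl; rewrite Rmult_0_l Rabs_R0; apply Rmult_le_pos; assumption. }
assert (fn0 : 0 < INR n`!) by (apply lt_0_INR; apply/ltP; exact: fact_gt0).
assert (Sn0 : 0 < INR n.+1) by (apply lt_0_INR; lia).
assert (fE : INR (n.+1)`! = INR n.+1 * INR n`!) by (rewrite factS -mult_INR; reflexivity).
assert (le : INR (Fcoef g n.+1) <= 4 ^ n.+1 * INR (CN (2 * n + 2 * g) (nseq n.+1 1%nat))).
{ rewrite -INR_exp4 -mult_INR; apply le_INR; apply/leP; exact: Fcoef_le_CN. }
rewrite Rabs_pos_eq.
2:{ apply Rmult_le_pos; [|apply pow_le; lra]; unfold Fseries; simpl.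
  apply Rmult_le_pos; [apply pos_INR|]; apply Rlt_le, Rinv_0_lt_compat.
  rewrite fE; nra. }
assert (HKn := HK n).
set (c := INR (CN (2 * n + 2 * g) (nseq n.+1 1%nat))) in *.
replace (Fseries g n.+1) with (INR (Fcoef g n.+1) / INR (n.+1)`!) by reflexivity.
assert (N1 : 1 <= INR n.+1) by (apply (le_INR 1); lia).
rewrite fE.
apply Rle_trans with (4 ^ n.+1 * c / (INR n.+1 * INR n`!) * (cubic s / 4) ^ n.+1).
{ apply Rmult_le_compat_r; [apply pow_le; lra|].
  apply Rmult_le_compat_r; [|exact le].
  apply Rlt_le, Rinv_0_lt_compat; nra. }
replace (4 ^ n.+1 * c / (INR n.+1 * INR n`!) * (cubic s / 4) ^ n.+1)
  with (c / INR n`! * cubic s ^ n * (cubic s / INR n.+1)).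
2:{ replace (cubic s / 4) with (cubic s * / 4) by reflexivity.
    rewrite Rpow_mult_distr pow_inv -!tech_pow_Rmult; field.
    repeat split; try lra; apply pow_nonzero; lra. }
apply Rle_trans with (K * (cubic s / INR n.+1)).
{ apply Rmult_le_compat_r; [|exact HKn].
  apply Rmult_le_pos; [exact c0|]; apply Rlt_le, Rinv_0_lt_compat; lra. }
rewrite (Rmult_comm (cubic s)); apply Rmult_le_compat_l; [exact K0|].
apply (Rmult_le_reg_r (INR n.+1)); [lra|].
unfold Rdiv; rewrite Rmult_assoc Rinv_l; [nra | lra].
Qed.

Lemma Fseries_radius_lower (g : nat) : Rbar_le (1 / 54) (CV_radius (Fseries g)).
Proof.
assert (H := Fseries_radius_ge g).
destruct (CV_radius (Fseries g)) as [r| |]; simpl.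
+ destruct (Rle_or_lt (1 / 54) r) as [h|h]; [exact h | exfalso].
  (* [cubic (1/3 + e) / 4 = 1/54 - e^2/2 - e^3] exceeds [r] for this [e]; the cap [1/12] keeps
     [1/3 + e] below [1/2]. *)
  set (e := Rmin (1 / 12) (1 / 54 - r)).
  assert (e0 : 0 < e) by (apply Rmin_glb_lt; lra).
  assert (e1 : e <= 1 / 12) by apply Rmin_l.
  assert (e2 : e <= 1 / 54 - r) by apply Rmin_r.
  assert (A := H (1 / 3 + e) ltac:(lra) ltac:(lra)); simpl in A.
  rewrite cubicE in A.
  assert (E : 2 * (1 / 3 + e) ^ 2 * (1 - 2 * (1 / 3 + e)) / 4 =
     1 / 54 - e * (e / 2 + e * e)) by field.
  nra.
+ exact I.
+ exact (H (5 / 12) ltac:(lra) ltac:(lra)).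
Qed.

Lemma Fseries_radius_upper (g : nat) : Rbar_le (CV_radius (Fseries g)) (2 / 27).
Proof.
(* Differentiation turns [d!] into [(d - 1)!], the normalisation of [fser]. *)
rewrite <- CV_radius_derive.
destruct (CV_radius_bounded (PS_derive (Fseries g))) as [_ lub].
apply lub; intros r [M HM]; simpl.
destruct (Rle_or_lt r (2 / 27)) as [h|h]; [exact h | exfalso].
apply not_fser_radius_gt.
destruct (CV_radius_bounded (fser 0)) as [ub _].
apply Rbar_lt_le_trans with r; [exact h|].
(* The comparison [Fcoef_ge_CN] starts at two points, so the constant term is bounded separately. *)
apply ub; exists (Rmax M (Rabs (fser 0 0 * r ^ 0))); intros [|n]; [apply Rmax_r|].
eapply Rle_trans; [|apply Rmax_l]; eapply Rle_trans; [|apply (HM n.+1)].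
assert (fn0 : 0 < INR (n.+1)`!) by (apply lt_0_INR; apply/ltP; exact: fact_gt0).
assert (Sn0 : 0 < INR n.+2) by (apply lt_0_INR; lia).
assert (fE : INR (n.+2)`! = INR n.+2 * INR (n.+1)`!) by (rewrite factS -mult_INR; reflexivity).
assert (i0 := Rinv_0_lt_compat _ fn0).
rewrite (Rabs_mult (fser 0 n.+1)) (Rabs_mult (PS_derive (Fseries g) n.+1)).
apply Rmult_le_compat_r; [apply Rabs_pos|].
assert (E : PS_derive (Fseries g) n.+1 = INR (Fcoef g n.+2) / INR (n.+1)`!).
{ unfold PS_derive.
  replace (Fseries g n.+2) with (INR (Fcoef g n.+2) / INR (n.+2)`!) by reflexivity.
  rewrite fE; field; lra. }
rewrite E fser0E.
assert (le : INR (CN (2 * n.+1) (nseq n.+2 1%nat)) <= INR (Fcoef g n.+2)).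
{ apply le_INR; apply/leP; exact: Fcoef_ge_CN. }
assert (p := pos_INR (CN (2 * n.+1) (nseq n.+2 1%nat))).
rewrite !Rabs_pos_eq; unfold Rdiv; nra.
Qed.

End Radius.

Theorem theorem1p1 (g : nat) :
  Rbar_le (Finite (1 / 54)%R) (CV_radius (Fseries g)) /\
  Rbar_le (CV_radius (Fseries g)) (Finite (2 / 27)%R).
Proof.
split.
- exact (Radius.Fseries_radius_lower g).
- exact (Radius.Fseries_radius_upper g).
Qed.
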